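(* For every $k\ge 1$, the toric Hilbert scheme of the determinantal ideal generated by the $2\times 2$ minors of a $3\times k$ matrix of indeterminates is connected.
   Context: Let $R=\mathbb{C}[x_{ij}: 1\le i\le 3,\ 1\le j\le k]$, graded by $\mathbb{Z}^3\oplus\mathbb{Z}^k$ via $\deg x_{ij}=e_i\oplus f_j$, where $e_1,e_2,e_3$ and $f_1,\dots,f_k$ are the standard bases (these degrees are the vertices of $\Delta^2\times\Delta^{k-1}$). Let $J$ be the ideal generated by the $2\times2$ minors of the matrix $(x_{ij})$; it is the toric ideal of this set of degrees, and it is homogeneous for the grading. Let $\mathcal{A}$ denote the set of all the degrees $e_i\oplus f_j$ and $\mathbb{N}\mathcal{A}$ the semigroup generated by it. The toric Hilbert scheme of $J$ is the multigraded Hilbert scheme parametrizing all ideals $I\subset R$ that are homogeneous for this grading and have the same multigraded Hilbert function as $J$, namely $\dim_{\mathbb{C}}(R/I)_b=1$ if $b\in\mathbb{N}\mathcal{A}$ and $0$ otherwise. *)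

(* Defs.v *)
From HB Require Import structures.
From mathcomp Require Import all_boot all_order all_algebra.
From mathcomp Require Import complex mpoly reals.

Set Implicit Arguments.
Unset Strict Implicit.
Unset Printing Implicit Defensive.

Import GRing.Theory.
Local Open Scope ring_scope.

Definition is_ideal (S : comNzRingType) (I : S -> Prop) : Prop :=
  [/\ I 0, forall p q, I p -> I q -> I (p + q) & forall a p, I p -> I (a * p)].

Definition ideal_gen (S : comNzRingType) (G : S -> Prop) : S -> Prop :=
  fun q => exists (l : nat) (a g : 'I_l -> S),
    (forall s, G (g s)) /\ q = \sum_s a s * g s.

Definition is_field (K : comNzRingType) : Prop :=
  forall x : K, x != 0 -> exists y, x * y = 1.

Definition mon_degree (G : zmodType) (n : nat) (deg : 'I_n -> G)
  (m : 'X_{1..n}) : G := \sum_(i < n) deg i *+ m i.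

Definition hcomp (G : zmodType) (n : nat) (deg : 'I_n -> G)
  (A : comNzRingType) (b : G) (p : {mpoly A[n]}) : {mpoly A[n]} :=
  \sum_(m <- msupp p | mon_degree deg m == b) p@_m *: 'X_[m].

Definition is_homogeneous_ideal (G : zmodType) (n : nat) (deg : 'I_n -> G)
  (A : comNzRingType) (I : {mpoly A[n]} -> Prop) : Prop :=
  is_ideal I /\ forall p b, I p -> I (hcomp deg b p).

(* With M := A[x]_b / I_b: the localization M_f is a free A_f-module of rank r.
   Up to units of A_f a basis of M_f comes from elements e_s of A[x]_b, and
   the two clauses say, after clearing denominators, that their images in M_f
   span it and are linearly independent.  For f = 1 it says that M itself is
   free of rank r. *)
Definition free_localization (G : zmodType) (n : nat) (deg : 'I_n -> G)
  (A : comNzRingType) (I : {mpoly A[n]} -> Prop) (b : G) (f : A) (r : nat)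
  : Prop :=
  exists e : 'I_r -> {mpoly A[n]},
    [/\ forall s, hcomp deg b (e s) = e s,
        forall p, hcomp deg b p = p ->
          exists (N : nat) (c : 'I_r -> A),
            I (f ^+ N *: p - \sum_s c s *: e s)
      & forall c : 'I_r -> A, I (\sum_s c s *: e s) ->
          exists N : nat, forall s, f ^+ N * c s = 0].

Definition locally_free_rank (G : zmodType) (n : nat) (deg : 'I_n -> G)
  (A : comNzRingType) (I : {mpoly A[n]} -> Prop) (b : G) (r : nat) : Prop :=
  exists (l : nat) (f g : 'I_l -> A),
    \sum_s g s * f s = 1 /\ forall s, free_localization deg I b (f s) r.

(* dim_C (C[x]/I)_b = h b for all b *)
Definition is_hilbert_function (G : zmodType) (n : nat) (deg : 'I_n -> G)
  (C : fieldType) (I : {mpoly C[n]} -> Prop) (h : G -> nat) : Prop :=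
  forall b, free_localization deg I b 1 (h b).

(* Schemes over C are given by their functors of points.  The functors needed
   here send a C-algebra A to a set of ideals of A[x_1, .., x_n], and act on
   phi : A -> B by I |-> I B[x_1, .., x_n]. *)
Definition ideal_functor (C : fieldType) (n : nat) :=
  forall A : comAlgType C, ({mpoly A[n]} -> Prop) -> Prop.

Definition base_change (n : nat) (A B : comNzRingType) (phi : A -> B)
  (I : {mpoly A[n]} -> Prop) : {mpoly B[n]} -> Prop :=
  ideal_gen (fun q => exists2 p, I p & q = map_mpoly phi p).

(* The Haiman-Sturmfels functor, represented by the multigraded Hilbert
   scheme. *)
Definition multigraded_hilbert_scheme (G : zmodType) (n : nat)
  (deg : 'I_n -> G) (C : fieldType) (h : G -> nat) : ideal_functor C n :=
  fun A I => is_homogeneous_ideal deg I /\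
             forall b, locally_free_rank deg I b (h b).

(* The Hilbert function h of J is unique, so [exists h] is only a way of
   naming it. *)
Definition toric_hilbert_scheme (G : zmodType) (n : nat) (deg : 'I_n -> G)
  (C : fieldType) (J : {mpoly C[n]} -> Prop) : ideal_functor C n :=
  fun A I => exists h : G -> nat,
    is_hilbert_function deg J h /\ multigraded_hilbert_scheme deg h I.

Definition is_subfunctor (C : fieldType) (n : nat) (X U : ideal_functor C n)
  : Prop :=
  (forall (A : comAlgType C) (I : {mpoly A[n]} -> Prop), U A I -> X A I) /\
  (forall (A B : comAlgType C) (phi : {lrmorphism A -> B})
     (I : {mpoly A[n]} -> Prop), U A I -> U B (base_change phi I)).

(* For every Spec A -> X the preimage of U is the open subset D(a) of Spec A,
   for some ideal a of A: a morphism phi : A -> B factors through D(a) iff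
   phi(a) B = B. *)
Definition is_open_subfunctor (C : fieldType) (n : nat)
  (X U : ideal_functor C n) : Prop :=
  is_subfunctor X U /\
  forall (A : comAlgType C) (I : {mpoly A[n]} -> Prop), X A I ->
    exists a : A -> Prop, is_ideal a /\
      forall (B : comAlgType C) (phi : {lrmorphism A -> B}),
        U B (base_change phi I) <->
        ideal_gen (fun y => exists2 x, a x & y = phi x) 1.

(* Connectedness of the underlying space |X|.  Its points are the elements of
   the X(K), K a field over C, up to field extension, and its open subsets are
   the |U|, U an open subfunctor of X; so inclusions and equalities between
   open subsets are tested on field-valued points.  |X| is connected if it is
   nonempty and is not the union of two disjoint nonempty open subsets. *)
Definition is_connected (C : fieldType) (n : nat) (X : ideal_functor C n)
  : Prop :=
  (exists (K : comAlgType C) (I : {mpoly K[n]} -> Prop),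
      is_field K /\ X K I) /\
  forall U V : ideal_functor C n,
    is_open_subfunctor X U -> is_open_subfunctor X V ->
    (forall (K : comAlgType C) (I : {mpoly K[n]} -> Prop),
       is_field K -> X K I -> U K I \/ V K I) ->
    (forall (K : comAlgType C) (I : {mpoly K[n]} -> Prop),
       is_field K -> ~ (U K I /\ V K I)) ->
    (forall (K : comAlgType C) (I : {mpoly K[n]} -> Prop),
       is_field K -> ~ U K I) \/
    (forall (K : comAlgType C) (I : {mpoly K[n]} -> Prop),
       is_field K -> ~ V K I).

(* The indeterminate x_ij is the variable of index [mxvec_index i j]; its
   degree is e_i (+) f_j, see [segre_degE]. *)
Definition segre_deg (d k : nat) (v : 'I_(d * k)) : 'rV[int]_d * 'rV[int]_k :=
  let ij := enum_val (cast_ord (esym (mxvec_cast d k)) v) in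
  (delta_mx 0 ij.1, delta_mx 0 ij.2).

Lemma segre_degE (d k : nat) (i : 'I_d) (j : 'I_k) :
  segre_deg (mxvec_index i j) = (delta_mx 0 i, delta_mx 0 j).
Proof. by rewrite /segre_deg /mxvec_index cast_ordK enum_rankK. Qed.

Definition generic_mx (C : comNzRingType) (d k : nat)
  : 'M[{mpoly C[d * k]}]_(d, k) := \matrix_(i, j) 'X_(mxvec_index i j).

Definition det2_ideal (C : comNzRingType) (d k : nat)
  : {mpoly C[d * k]} -> Prop :=
  ideal_gen (fun q => exists (i i' : 'I_d) (j j' : 'I_k),
    [/\ (i < i')%N, (j < j')%N
      & q = generic_mx C d k i j * generic_mx C d k i' j'
            - generic_mx C d k i j' * generic_mx C d k i' j]).

(* Main.v *)
(* A point of the scheme over a field K amounts to a function c from monomials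
   to K, where x^m = c(m) * generator in degree deg m.  Replacing c(m) by
   c(m) t^(w(m) - min w) gives a family over K[t] joining the point to its
   initial degeneration; since K is infinite, disjoint open subsets cannot
   separate two fibres of such a family.  So every point lies on the same side
   as a monomial one, defined over C, and it remains to join any monomial ideal
   (a set S of standard monomials) to the determinantal ideal by
   degenerations and their inverses.

   For rows i, i', put a <= b when x_ia x_i'b is standard; this is a total order
   on the columns.  Flips of quadratic and cubic binomials keep the orders of
   the row pairs 12 and 13 and sort the order 23 into the order 13: take the
   13-smallest column h that is 23-above some column 13-above it, and the
   23-largest such column j.  If some l > h for the order 12 has x_1l x_2j x_3h
   standard, then for the 12-largest such l the cubic flip
   x_1l x_2j x_3h -> x_1h x_2l x_3j is possible; otherwise the quadratic flip
   x_2j x_3h -> x_2h x_3j is.  When the orders 13 and 23 agree, S is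
   the set of standard monomials of a lexicographic initial ideal of the
   determinantal ideal. *)

Require Import Defs.
From HB Require Import structures.
From mathcomp Require Import all_boot all_order all_algebra.
From mathcomp Require Import complex mpoly reals.
From mathcomp Require boolp.
From mathcomp Require Import zify ring.

Set Implicit Arguments.
Unset Strict Implicit.
Unset Printing Implicit Defensive.

Import GRing.Theory Num.Theory.
Local Open Scope ring_scope.

(** Since two monomials of equal degree differ by a circuit of length 4 or 6, a monomial is standard
    as soon as its divisors $x_{ia}x_{jb}$ and $x_{1a}x_{2b}x_{3c}$ are. So [S] is encoded by three
    orders on the columns and a choice of cubics.

    What obstructs reversing h and j in the order 23 is a standard $x_{1l}x_{2j}x_{3h}$ with l above
    h in the order 12: after the reversal $x_{1l}$ would sit next to $x_{2h}$, and that pair is not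
    standard. A cubic flip removes one such obstruction and leaves the three orders alone. This is
    why the induction counts inversions first and obstructing cubics second. The extremal choices of
    h, j and l serve to rule out the cyclic rotations of a cubic, which compete with it for being
    standard.

    Geometry enters the sorting only through a predicate on sets of monomials that is insensitive to
    initial degeneration. *)

Section Ideals.
Variables (A : comNzRingType) (I : A -> Prop).
Hypothesis idI : is_ideal I.

Lemma ideal0 : I 0. Proof. by case: idI. Qed.

Lemma idealD p q : I p -> I q -> I (p + q).
Proof. by case: idI => _ + _; apply. Qed.

Lemma idealM a p : I p -> I (a * p).
Proof. by case: idI => _ _; apply. Qed.

Lemma idealN p : I p -> I (- p).
Proof. by rewrite -mulN1r; apply: idealM. Qed.

Lemma idealB p q : I p -> I q -> I (p - q).
Proof. by move=> Ip Iq; apply: idealD => //; apply: idealN. Qed.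

Lemma ideal_sum (T : eqType) (r : seq T) (P : pred T) (F : T -> A) :
  (forall x, x \in r -> P x -> I (F x)) -> I (\sum_(x <- r | P x) F x).
Proof.
move=> IF; rewrite big_seq_cond; apply: (big_ind I).
- exact: ideal0.
- exact: idealD.
- by move=> x /andP[]; apply: IF.
Qed.

End Ideals.

Lemma ideal_gen_ideal (A : comNzRingType) (S : A -> Prop) :
  is_ideal (ideal_gen S).
Proof.
split.
- exists 0%N, (fun _ => 0), (fun _ => 0).
  by split; [case | rewrite big_ord0].
- move=> _ _ [l [a [g [Sg ->]]]] [l' [a' [g' [Sg' ->]]]].
  exists (l + l')%N.
  exists (fun s => match split s with inl i => a i | inr i => a' i end).
  exists (fun s => match split s with inl i => g i | inr i => g' i end).
  split; first by move=> s; case: (split s).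
  rewrite big_split_ord /=; congr (_ + _); apply: eq_bigr => i _.
    by rewrite (unsplitK (inl i)).
  by rewrite (unsplitK (inr i)).
- move=> c _ [l [a [g [Sg ->]]]]; exists l, (fun s => c * a s), g; split=> //.
  by rewrite big_distrr; apply: eq_bigr => i _; rewrite /= mulrA.
Qed.

Lemma mem_ideal_gen (A : comNzRingType) (S : A -> Prop) g :
  S g -> ideal_gen S g.
Proof.
by move=> Sg; exists 1%N, (fun _ => 1), (fun _ => g); rewrite big_ord1 mul1r.
Qed.

Lemma ideal_gen_min (A : comNzRingType) (S I : A -> Prop) :
  is_ideal I -> (forall g, S g -> I g) -> forall p, ideal_gen S p -> I p.
Proof.
move=> idI SI _ [l [a [g [Sg ->]]]].
by apply: ideal_sum => // s _ _; apply: (idealM idI); apply: SI.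
Qed.

(** * Ideals given by a coefficient function on monomials *)

Section Graded.
Variables (G : zmodType) (n : nat) (deg : 'I_n -> G).
Notation mon := 'X_{1..n}.
Notation dg := (mon_degree deg).

Lemma mon_degreeD (m m' : mon) : dg (m + m')%MM = dg m + dg m'.
Proof.
rewrite /mon_degree -big_split /=; apply: eq_bigr => i _.
by rewrite mnmDE mulrnDr.
Qed.

Section Ev.
Variable A : comNzRingType.

Definition ev (c : mon -> A) (b : G) (p : {mpoly A[n]}) : A :=
  \sum_(m <- msupp p | dg m == b) p@_m * c m.

Lemma ev_supp c b (p : {mpoly A[n]}) (s : seq mon) :
  uniq s -> {subset msupp p <= s} ->
  ev c b p = \sum_(m <- s | dg m == b) p@_m * c m.
Proof.
move=> us sub; rewrite /ev.
rewrite [RHS](bigID (fun m => m \in msupp p)) /= [X in _ + X]big1 ?addr0; last first.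
  by move=> m /andP[_ /memN_msupp_eq0 ->]; rewrite mul0r.
rewrite -[RHS]big_filter -[LHS]big_filter; apply: perm_big.
apply: uniq_perm; rewrite ?filter_uniq ?msupp_uniq // => m.
rewrite !mem_filter; case: (dg m == b) => //=.
by case: (boolP (m \in msupp p)) => // /sub ->.
Qed.

Lemma ev_is_linear c b : linear_for *%R (ev c b).
Proof.
move=> a p q; pose s := undup (msupp (a *: p + q) ++ msupp p ++ msupp q).
rewrite !(@ev_supp _ _ _ s) ?undup_uniq // => [|m|m|m]; last first.
- by rewrite mem_undup !mem_cat => ->.
- by rewrite mem_undup !mem_cat => ->; rewrite !orbT.
- by rewrite mem_undup !mem_cat => ->; rewrite !orbT.
rewrite big_distrr -big_split /=; apply: eq_bigr => m _.
by rewrite mcoeffD mcoeffZ mulrDl mulrA.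
Qed.

HB.instance Definition _ c b :=
  GRing.isLinear.Build A {mpoly A[n]} A *%R (ev c b) (ev_is_linear c b).

Lemma evX c b m : ev c b 'X_[m] = if dg m == b then c m else 0.
Proof. by rewrite /ev msuppX big_cons big_nil mcoeffX eqxx mul1r addr0. Qed.

Lemma mcoeff_hcomp b (p : {mpoly A[n]}) m :
  (hcomp deg b p)@_m = if dg m == b then p@_m else 0.
Proof.
rewrite /hcomp raddf_sum /=.
have -> : \sum_(i <- msupp p | dg i == b) (p@_i *: 'X_[i])@_m =
  \sum_(i <- msupp p | (dg i == b) && (i == m)) p@_i.
  rewrite big_mkcondr; apply: eq_bigr => i _; rewrite mcoeffZ mcoeffX.
  by case: eqP; rewrite ?mulr1 ?mulr0.
case: ifP => dm; last by rewrite big1 // => i /andP[/[swap] /eqP->]; rewrite dm.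
rewrite (eq_bigl (pred1 m)) => [|i]; last first.
  by rewrite andbC /=; case: eqP => // ->.
case: (boolP (m \in msupp p)) => mp.
  by rewrite -big_filter filter_pred1_uniq ?msupp_uniq // big_seq1.
rewrite (memN_msupp_eq0 mp) big1_seq // => i /andP[/eqP->].
by rewrite (negPf mp).
Qed.

Lemma ev_hcomp c b b' p :
  ev c b (hcomp deg b' p) = if b == b' then ev c b p else 0.
Proof.
rewrite (@ev_supp c b _ (msupp p)) ?msupp_uniq //; last first.
  move=> m; rewrite !mcoeff_msupp mcoeff_hcomp.
  by case: ifP => //; rewrite eqxx.
case: eqP => [<-|bb'].
  by apply: eq_bigr => m mb; rewrite mcoeff_hcomp mb.
rewrite big1 // => m /eqP mb; rewrite mcoeff_hcomp mb.
by case: eqP => // _; rewrite mul0r.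
Qed.

(* [cohI c] is an ideal with quotient free of rank at most one in each degree:
   in degree b it is the kernel of the functional sending x^m to c m. *)
Definition coh (c : mon -> A) : Prop :=
  (forall m, exists2 s, dg s = dg m & c s = 1) /\
  (forall m m' v, dg m = dg m' -> c m * c (m' + v)%MM = c m' * c (m + v)%MM).

Definition cohI (c : mon -> A) (p : {mpoly A[n]}) : Prop :=
  forall b, ev c b p = 0.

Lemma ev_homog c b p : hcomp deg b p = p -> forall b', b != b' -> ev c b' p = 0.
Proof. by move=> <- b' /negPf nb; rewrite ev_hcomp eq_sym nb. Qed.

Definition semigroup_indicator (b : G) : nat :=
  boolp.asbool (exists m, dg m = b).

Lemma hcomp_outside b (p : {mpoly A[n]}) :
  ~ (exists m, dg m = b) -> hcomp deg b p = 0.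
Proof.
move=> no; apply/mpolyP => m; rewrite mcoeff_hcomp mcoeff0.
by case: eqP => // e; case: no; exists m.
Qed.

Lemma hcompX m : hcomp deg (dg m) 'X_[m] = 'X_[A, m].
Proof.
apply/mpolyP => m'; rewrite mcoeff_hcomp mcoeffX.
by case: (eqVneq m m') => [->|_]; rewrite ?eqxx ?if_same.
Qed.

Section CohIdeal.
Variable c : mon -> A.
Hypothesis cc : coh c.

(** Coherence gives [c (m + v) = c m * c (s + v)] for every [m] of the degree of a monomial [s] with
    [c s = 1]. So the functional in degree [dg (s + v)], composed with multiplication by x^v, is a
    multiple of the one in degree [dg s]. *)
Lemma cohI_mulX p v : cohI c p -> cohI c ('X_[v] * p).
Proof.
move=> Ip b; rewrite {1}[p]mpolyE mulr_sumr raddf_sum /=.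
under eq_bigr => m _ do
  rewrite -scalerAr linearZ /= -mpolyXD evX mon_degreeD.
have [[m0 <-]|no] := boolp.pselect (exists m, dg v + dg m = b); last first.
  rewrite big1 // => m _; case: eqP => [e|]; last by rewrite mulr0.
  by case: no; exists m.
have [s ds cs] := cc.1 m0; rewrite -ds.
transitivity (ev c (dg s) p * c (s + v)%MM); last by rewrite Ip mul0r.
rewrite /ev mulr_suml [RHS]big_mkcond; apply: eq_bigr => m _ /=.
rewrite (inj_eq (addrI _)); case: eqP => [e|]; last by rewrite mulr0.
by rewrite -mulrA (cc.2 _ _ _ e) cs mul1r addmC.
Qed.

Lemma cohI_ideal : is_ideal (cohI c).
Proof.
have idD p q : cohI c p -> cohI c q -> cohI c (p + q).
  by move=> Ip Iq b; rewrite raddfD /= Ip Iq addr0.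
split=> // [b|a p Ip]; first by rewrite raddf0.
rewrite [a]mpolyE mulr_suml; apply: (big_ind (cohI c)) => // [b|m _].
  by rewrite raddf0.
by move=> b; rewrite -scalerAl linearZ /= cohI_mulX ?mulr0.
Qed.

Lemma cohI_homogeneous : is_homogeneous_ideal deg (cohI c).
Proof.
split; first exact: cohI_ideal.
by move=> p b Ip b'; rewrite ev_hcomp Ip if_same.
Qed.

Lemma cohI_free b : free_localization deg (cohI c) b 1 (semigroup_indicator b).
Proof.
rewrite /semigroup_indicator; case: boolp.asboolP => [[m mb]|no] /=; last first.
  exists (fun _ => 0); split=> [[]//|p <-|c' _]; last by exists 0%N => -[].
  exists 0%N, (fun _ => 0); rewrite hcomp_outside // scaler0 big1 ?subrr.
    exact: ideal0 cohI_ideal.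
  by move=> i; rewrite scaler0.
have [s ds cs] := cc.1 m.
exists (fun _ => 'X_[s]); split=> [_|p pb|a].
- by rewrite -mb -ds hcompX.
- exists 0%N, (fun _ => ev c b p) => b'; rewrite big_ord1 expr0 scale1r.
  rewrite raddfB /= linearZ /= evX ds mb.
  case: (eqVneq b b') => [<-|nb]; first by rewrite cs mulr1 subrr.
  by rewrite (ev_homog _ pb nb) mulr0 subrr.
- rewrite big_ord1 => /(_ b); rewrite linearZ /= evX ds mb eqxx cs mulr1 => a0.
  by exists 0%N => i; rewrite (ord1 i) a0 mulr0.
Qed.

Lemma cohI_locally_free b :
  locally_free_rank deg (cohI c) b (semigroup_indicator b).
Proof.
exists 1%N, (fun _ => 1), (fun _ => 1); rewrite big_ord1 mul1r; split=> // _.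
exact: cohI_free.
Qed.

End CohIdeal.
End Ev.

Lemma coh_morph (A B : comNzRingType) (phi : {rmorphism A -> B}) c :
  coh c -> coh (phi \o c).
Proof.
move=> [c1 c2]; split=> [m|m m' v e] /=; last by rewrite -!rmorphM c2.
by have [s ds cs] := c1 m; exists s; rewrite //= cs rmorph1.
Qed.

(** Subtracting the binomials leaves a polynomial supported on the representatives [r b], where its
    coefficient is [ev c b q], zero by membership. *)
Lemma cohI_expand (A : comNzRingType) (c : mon -> A) (r : G -> mon) q :
  (forall m, dg (r (dg m)) = dg m) -> cohI c q ->
  q = \sum_(m <- msupp q) q@_m *: ('X_[m] - c m *: 'X_[r (dg m)]).
Proof.
move=> rP Iq; rewrite {1}[q]mpolyE; apply/eqP; rewrite -subr_eq0 -sumrB.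
apply/eqP/mpolyP => m0; rewrite raddf_sum /= mcoeff0.
transitivity ((r (dg m0) == m0)%:R * ev c (dg m0) q);
  last by rewrite Iq mulr0.
rewrite /ev big_distrr [RHS]big_mkcond; apply: eq_bigr => m _ /=.
rewrite -scalerBr mcoeffZ !mcoeffB mcoeffZ !mcoeffX opprB addrC subrK.
have -> : (r (dg m) == m0) = (r (dg m0) == m0) && (dg m == dg m0).
  case: (eqVneq (dg m) (dg m0)) => [->|ne]; first by rewrite andbT.
  by rewrite andbF; apply/eqP => e; move/eqP: ne; rewrite -e rP.
by case: (r (dg m0) == m0); case: eqP; rewrite ?mulr1 ?mulr0 ?mul0r ?mul1r.
Qed.

(** The ideal over [B] is generated by binomials x^m - c(m) x^(r(deg m)) that already come from [A];
    choosing [r] with value 1 under [c] puts them in the ideal over [A]. *)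
Lemma base_change_cohI (A B : comNzRingType) (phi : {rmorphism A -> B}) c :
  coh c -> base_change phi (cohI c) = cohI (phi \o c).
Proof.
move=> cc; apply: boolp.funext => q; apply: boolp.propext; split.
  apply: ideal_gen_min; first exact: cohI_ideal (coh_morph _ cc).
  move=> _ [p Ip ->] b; rewrite (@ev_supp _ _ _ _ (msupp p)) ?msupp_uniq //.
    rewrite -[RHS](rmorph0 phi) -(Ip b) /ev rmorph_sum; apply: eq_bigr => m _ /=.
    by rewrite mcoeff_map_mpoly rmorphM.
  move=> m; rewrite !mcoeff_msupp mcoeff_map_mpoly.
  by apply: contra_neq => ->; exact: rmorph0.
move=> Iq.
have [r rP] : exists r : G -> mon,
    forall m, dg (r (dg m)) = dg m /\ c (r (dg m)) = 1.
  have /boolp.choice[r rP] : forall b, exists s,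
      (exists m, dg m = b) -> dg s = b /\ c s = 1.
    move=> b; have [[m <-]|no] := boolp.pselect (exists m, dg m = b).
      by have [s] := cc.1 m; exists s.
    by exists 0%MM => /no.
  by exists r => m; apply: rP; exists m.
rewrite (cohI_expand (fun m => (rP m).1) Iq).
apply: ideal_sum => [|m _ _]; first exact: ideal_gen_ideal.
rewrite -mul_mpolyC; apply: idealM; first exact: ideal_gen_ideal.
apply: mem_ideal_gen; exists ('X_[m] - c m *: 'X_[r (dg m)]) => [b|].
  rewrite raddfB /= linearZ /= !evX (rP m).1 (rP m).2.
  by case: ifP; rewrite ?mulr1 ?subrr // mulr0 subr0.
by rewrite raddfB /= map_mpolyZ !map_mpolyX.
Qed.

(** In each degree that occurs the two functionals differ by a unit, hence have the same kernel. *)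
Lemma scale_cohI (A : comNzRingType) (c c' : mon -> A) (u : G -> A) :
  (forall m, exists a, a * u (dg m) = 1) ->
  (forall m, c' m = u (dg m) * c m) -> cohI c' = cohI c.
Proof.
move=> uU c'E; apply: boolp.funext => p; apply: boolp.propext.
have evE b : ev c' b p = u b * ev c b p.
  rewrite /ev mulr_sumr; apply: eq_bigr => m /eqP mb.
  by rewrite c'E mb mulrCA.
split=> Ip b; last by rewrite evE Ip mulr0.
have [[m mb]|no] := boolp.pselect (exists m, dg m = b).
  have [a au] := uU m.
  by rewrite -[LHS]mul1r -au mb -mulrA -evE Ip mulr0.
by rewrite /ev big1 // => m /eqP mb; case: no; exists m.
Qed.

End Graded.

(** * Polynomials over a field and evaluation of the parameter *)

Lemma is_field_mulf_eq0 (K : comNzRingType) (x y : K) :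
  is_field K -> x * y = 0 -> x != 0 -> y = 0.
Proof.
by move=> fK xy0 /fK[z xz]; rewrite -[y]mul1r -xz mulrAC xy0 mul0r.
Qed.

Lemma is_field_poly_mulf_neq0 (K : comNzRingType) (p q : {poly K}) :
  is_field K -> p != 0 -> q != 0 -> p * q != 0.
Proof.
move=> fK p0 q0; rewrite -lead_coef_eq0 lead_coef_proper_mul.
  apply/eqP => /(is_field_mulf_eq0 fK)/(_ _)/eqP.
  by rewrite !lead_coef_eq0 (negPf q0) => /(_ p0).
apply/eqP => /(is_field_mulf_eq0 fK)/(_ _)/eqP.
by rewrite !lead_coef_eq0 (negPf q0) => /(_ p0).
Qed.

(** Dividing by the factor of the root [a%:R] lowers the size; the known roots shrink to j > a,
    where [j%:R - a%:R] is nonzero. *)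
Lemma poly_eq0_natr (K : comNzRingType) (p : {poly K}) (a : nat) :
  is_field K -> (forall m, m.+1%:R != 0 :> K) ->
  (forall j, (a <= j)%N -> p.[j%:R] = 0) -> p = 0.
Proof.
move=> fK char0.
have [N] := ubnP (size p); elim: N p a => // N IHN p a ltN pa.
have /factor_theorem[q pq] : root p a%:R by apply/rootP/pa.
have [q0|q0] := eqVneq q 0; first by rewrite pq q0 mul0r.
suff q00 : q = 0 by rewrite q00 eqxx in q0.
apply: (IHN q a.+1).
  by move: ltN; rewrite pq size_Mmonic ?monicXsubC // size_XsubC addn2.
move=> j aj; apply: (is_field_mulf_eq0 fK (x := j%:R - a%:R)).
  rewrite mulrC -[RHS](pa j (ltnW aj)) pq hornerM !hornerE.
  by rewrite ?hornerE.
by rewrite -natrB 1?ltnW // -subnSK.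
Qed.

Lemma field_nonroot2 (K : comNzRingType) (p q : {poly K}) :
  is_field K -> (forall m, m.+1%:R != 0 :> K) -> p != 0 -> q != 0 ->
  exists x, p.[x] != 0 /\ q.[x] != 0.
Proof.
move=> fK char0 p0 q0; apply: boolp.contrapT => no.
have/eqP := is_field_poly_mulf_neq0 fK p0 q0; apply.
apply: (poly_eq0_natr (a := 0)) => // j _; rewrite hornerM.
have [->|px] := eqVneq p.[j%:R] 0; first by rewrite mul0r.
have [->|qx] := eqVneq q.[j%:R] 0; first by rewrite mulr0.
by case: no; exists j%:R.
Qed.

(* {poly K} is canonically an algebra over K only, not over C. *)
Definition alg_poly (C : nzRingType) (K : comAlgType C) := {poly K}.

Section AlgPoly.
Variables (C : comNzRingType) (K : comAlgType C).

HB.instance Definition _ := GRing.ComNzRing.copy (alg_poly K) {poly K}.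

Definition alg_poly_scale (a : C) (p : alg_poly K) : alg_poly K := a%:A%:P * p.

Lemma alg_poly_scaleA a b p :
  alg_poly_scale a (alg_poly_scale b p) = alg_poly_scale (a * b) p.
Proof. by rewrite /alg_poly_scale mulrA -polyCM -scalerAl mul1r scalerA. Qed.

Lemma alg_poly_scale1 : left_id 1 alg_poly_scale.
Proof. by move=> p; rewrite /alg_poly_scale scale1r mul1r. Qed.

Lemma alg_poly_scaleDr : right_distributive alg_poly_scale +%R.
Proof. by move=> a p q; rewrite /alg_poly_scale mulrDr. Qed.

Lemma alg_poly_scaleDl p : {morph alg_poly_scale^~ p : a b / a + b}.
Proof. by move=> a b; rewrite /alg_poly_scale scalerDl polyCD mulrDl. Qed.

HB.instance Definition _ := GRing.Zmodule_isLmodule.Build C (alg_poly K)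
  alg_poly_scaleA alg_poly_scale1 alg_poly_scaleDr alg_poly_scaleDl.

Lemma alg_poly_scaleAl (a : C) (p q : alg_poly K) : a *: (p * q) = a *: p * q.
Proof. exact: mulrA. Qed.

HB.instance Definition _ :=
  GRing.Lmodule_isLalgebra.Build C (alg_poly K) alg_poly_scaleAl.

HB.instance Definition _ :=
  GRing.Lalgebra_isComAlgebra.Build C (alg_poly K).

Definition alg_poly_eval (x : K) (p : alg_poly K) : K := horner p x.

Lemma alg_poly_eval_additive x : zmod_morphism (alg_poly_eval x).
Proof. by move=> p q; rewrite /alg_poly_eval hornerD hornerN. Qed.

Lemma alg_poly_eval_multiplicative x : monoid_morphism (alg_poly_eval x).
Proof. by split=> [|p q]; [apply: hornerC | apply: hornerM]. Qed.

Lemma alg_poly_eval_scalable x : scalable (alg_poly_eval x).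
Proof.
by move=> a p; rewrite /alg_poly_eval hornerM hornerC -scalerAl mul1r.
Qed.

HB.instance Definition _ x := GRing.isZmodMorphism.Build (alg_poly K) K
  (alg_poly_eval x) (alg_poly_eval_additive x).
HB.instance Definition _ x := GRing.isMonoidMorphism.Build (alg_poly K) K
  (alg_poly_eval x) (alg_poly_eval_multiplicative x).
HB.instance Definition _ x := GRing.isScalable.Build C (alg_poly K) K *:%R
  (alg_poly_eval x) (alg_poly_eval_scalable x).

End AlgPoly.

(** Over a field, the condition defining an open subfunctor thus says that some element of the ideal
    does not vanish at the point. *)
Lemma ideal_gen1_field (K : comNzRingType) (S : K -> Prop) :
  is_field K -> ideal_gen S 1 <-> exists2 x, S x & x != 0.
Proof.
move=> fK; split=> [|[x Sx /fK[y xy]]]; last first.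
  by rewrite -xy mulrC; apply: idealM (mem_ideal_gen Sx); apply: ideal_gen_ideal.
move=> [l [a [g [Sg e]]]]; apply: boolp.contrapT => no.
move/eqP: e; apply/negP; rewrite big1 ?oner_neq0 // => s _.
have [->|g0] := eqVneq (g s) 0; first by rewrite mulr0.
by case: no; exists (g s).
Qed.

(** * Weights, and initial degenerations seen on supports *)

Section Weights.
Variables (G : zmodType) (n : nat) (deg : 'I_n -> G).
Notation mon := 'X_{1..n}.
Notation dg := (mon_degree deg).

Definition wt (w : 'I_n -> nat) (m : mon) : nat := (\sum_v w v * m v)%N.

Lemma wtD w m m' : wt w (m + m')%MM = (wt w m + wt w m')%N.
Proof.
by rewrite /wt -big_split; apply: eq_bigr => v _; rewrite mnmDE mulnDr.
Qed.

Definition delta_wt (v i : 'I_n) : nat := i == v.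

Lemma wt_delta v (m : mon) : wt (delta_wt v) m = m v.
Proof.
rewrite /wt (bigD1 v) //= /delta_wt eqxx mul1n big1 ?addn0 // => i /negPf->.
by rewrite mul0n.
Qed.

(** When [P] is the support of a coherent function, this is the support of its limit at t = 0 in the
    family that [w] defines. *)
Definition initial (w : 'I_n -> nat) (P : mon -> bool) (m : mon) : bool :=
  P m && boolp.asbool (forall m', dg m' = dg m -> P m' -> (wt w m <= wt w m')%N).

Lemma initialP w (P : mon -> bool) m : reflect
  (P m /\ forall m', dg m' = dg m -> P m' -> (wt w m <= wt w m')%N)
  (initial w P m).
Proof.
apply: (iffP andP) => [[Pm /boolp.asboolP]//|[Pm mm]].
by split=> //; apply/boolp.asboolP.
Qed.

Lemma initial_exists w (P : mon -> bool) m : P m ->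
  exists2 m', dg m' = dg m & initial w P m'.
Proof.
have [N] := ubnP (wt w m); elim: N m => // N IHN m ltN Pm.
have [mm|] := boolp.pselect
  (forall m', dg m' = dg m -> P m' -> (wt w m <= wt w m')%N).
  by exists m => //; apply/initialP.
move/boolp.existsNP => [m' /boolp.not_implyP[e /boolp.not_implyP[Pm' /negP]]].
rewrite -ltnNge => lt; have [m'' e' i] := IHN m' (leq_trans lt ltN) Pm'.
by exists m''; rewrite // e'.
Qed.

(** The condition [coh] for values 0 and 1: a product of such values is a conjunction, and
    exchanging [m] and [m'] turns the implication into an equality. *)
Definition pcoh (P : mon -> bool) : Prop :=
  (forall m, exists2 s, dg s = dg m & P s) /\
  (forall m m' v, dg m = dg m' -> P m -> P (m' + v)%MM -> P m' && P (m + v)%MM).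

Definition chi (A : nzRingType) (P : mon -> bool) (m : mon) : A := (P m)%:R.

Lemma coh_chi (A : comNzRingType) P : pcoh P -> coh deg (chi A P).
Proof.
move=> [P1 P2]; split=> [m|m m' v e].
  by have [s ds Ps] := P1 m; exists s; rewrite // /chi Ps.
rewrite /chi -!natrM !mulnb; congr (_%:R : A); congr nat_of_bool.
by apply/andP/andP => -[Pm Pv]; apply/andP; apply: P2 Pv.
Qed.

Lemma chi_morph (A B : comNzRingType) (phi : {rmorphism A -> B}) P :
  phi \o chi A P = chi B P.
Proof. by apply: boolp.funext => m; rewrite /chi /= rmorph_nat. Qed.

End Weights.

(** * Families over the affine line and the two sides of a cover *)

Section Sides.
Variables (C : numFieldType) (G : zmodType) (n : nat) (deg : 'I_n -> G).
Notation mon := 'X_{1..n}.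
Notation dg := (mon_degree deg).
Variable X : ideal_functor C n.
Hypothesis cohX : forall (A : comAlgType C) (c : mon -> A),
  coh deg c -> X (cohI deg c).
Variables U V : ideal_functor C n.
Hypotheses (oU : is_open_subfunctor X U) (oV : is_open_subfunctor X V).
Hypothesis disj : forall (K : comAlgType C) (I : {mpoly K[n]} -> Prop),
  is_field K -> ~ (U I /\ V I).
Hypothesis cover : forall (K : comAlgType C) (I : {mpoly K[n]} -> Prop),
  is_field K -> X I -> U I \/ V I.

Lemma natr_neq0_alg (K : comAlgType C) m : m.+1%:R != 0 :> K.
Proof.
rewrite -(rmorph_nat (in_alg K)) /=.
apply/negP => /eqP e; have := oner_neq0 K.
rewrite -(scale1r (1 : K)) -(@mulVf C m.+1%:R) ?pnatr_eq0 //.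
by rewrite -scalerA e scaler0 eqxx.
Qed.

(* Each of the open subsets U and V pulls back to the locus where some
   polynomial does not vanish; as K is infinite, both are nonzero at a common
   value of t, unless one of them is zero. *)
Lemma family_side (K : comAlgType C) (c : mon -> alg_poly K) x y :
  is_field K -> coh deg c -> U (cohI deg (alg_poly_eval x \o c)) ->
  V (cohI deg (alg_poly_eval y \o c)) -> False.
Proof.
move=> fK cc; rewrite -!(base_change_cohI _ cc) => Ux Vy.
have [a [ida aP]] := oU.2 _ _ (cohX cc).
have [b [idb bP]] := oV.2 _ _ (cohX cc).
move: Ux => /aP/(ideal_gen1_field _ fK)[_ [f af ->] fx].
move: Vy => /bP/(ideal_gen1_field _ fK)[_ [g bg ->] gy].

have [||z [fz gz]] := field_nonroot2 fK (@natr_neq0_alg K) (_ : f != 0) (_ : g != 0).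
- by apply: contra_neq fx => ->; apply: horner0.
- by apply: contra_neq gy => ->; apply: horner0.
apply: (@disj K (base_change (alg_poly_eval z) (cohI deg c)) fK); split.
- by apply/aP/ideal_gen1_field => //; exists (f.[z]) => //; exists f.
- by apply/bP/ideal_gen1_field => //; exists (g.[z]) => //; exists g.
Qed.

(* The family c m * t^(wt w m - min wt w), rescaled by a unit in each degree. *)
Lemma degenerate (K : comAlgType C) (c : mon -> K) w :
  is_field K -> coh deg c ->
  exists c' : mon -> K,
    [/\ coh deg c', forall m, (c' m != 0) = initial deg w (fun m => c m != 0) m,
        (forall m, c m = (c m != 0)%:R) -> forall m, c' m = (c' m != 0)%:R
      & U (cohI deg c) -> U (cohI deg c')].
Proof.
move=> fK cc; pose P m := c m != 0.
have /boolp.choice[s sP] : forall b, exists s,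
    (exists m, dg m = b) -> dg s = b /\ initial deg w P s.
  move=> b; have [[m <-]|no] := boolp.pselect (exists m, dg m = b); last first.
    by exists 0%MM.
  have [s ds cs] := cc.1 m.
  have [|s' ds' is'] := @initial_exists _ _ deg w P s.
    by rewrite /P cs oner_neq0.
  by exists s'; rewrite ds' ds.
have sdg m : dg (s (dg m)) = dg m by case: (sP (dg m)) => //; exists m.
have sin m : initial deg w P (s (dg m)) by case: (sP (dg m)) => //; exists m.
have /boolp.choice[u uP] : forall b, exists u, c (s b) != 0 -> u * c (s b) = 1.
  move=> b; have [->|/fK[y xy]] := eqVneq (c (s b)) 0; first by exists 0.
  by exists y; rewrite mulrC.
have us m : u (dg m) * c (s (dg m)) = 1.
  by apply: uP; case/initialP: (sin m).
have smin m m' : dg m = dg m' -> P m' -> (wt w (s (dg m)) <= wt w m')%N.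
  by move=> e; case/initialP: (sin m) => _; apply; rewrite sdg.
pose ct m : alg_poly K :=
  (u (dg m) * c m)%:P * 'X^(wt w m - wt w (s (dg m))).
have cct : coh deg ct.
  split=> [m|m m' v e].
    exists (s (dg m)); rewrite // /ct sdg us subnn expr0 mulr1.
    by [].
  have ev' : dg (m + v)%MM = dg (m' + v)%MM by rewrite !mon_degreeD e.
  have ctM (a b a' b' : K) i j : ((a * b)%:P * 'X^i) * ((a' * b')%:P * 'X^j) =
      (a * a' * (b * b'))%:P * 'X^(i + j) :> {poly K}.
    by rewrite mulrACA -polyCM -exprD [a * b * _]mulrACA.
  rewrite /ct !ctM e ev' (cc.2 _ _ _ e).
  (* When this product is nonzero all four monomials lie in the support, so their weights are at
     least the minima and the truncated subtractions in the exponents are exact. *)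
  have [->|nz] := eqVneq (c m' * c (m + v)%MM) 0; first by rewrite !mulr0 !mul0r.
  have nz' : c m * c (m' + v)%MM != 0 by rewrite (cc.2 _ _ _ e).
  have Pl x y : x * y != 0 -> x != 0 :> K by apply: contra_neq => ->; rewrite mul0r.
  have Pr x y : x * y != 0 -> y != 0 :> K by apply: contra_neq => ->; rewrite mulr0.
  have := smin _ _ (esym e) (Pl _ _ nz'); have := smin _ _ erefl (Pl _ _ nz).
  have := smin _ _ (esym ev') (Pr _ _ nz); have := smin _ _ erefl (Pr _ _ nz').
  rewrite !wtD => le1 le2 le3 le4; congr (_ * 'X^_).
  move: le1 le2 le3 le4.
  move: (wt w (s (dg m'))) (wt w (s (dg (m' + v)%MM))) (wt w m) (wt w m') (wt w v).
  by move=> x1 x2 x3 x4 x5; lia.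
pose c' := alg_poly_eval 0 \o ct.
have c'E m : c' m = u (dg m) * c m * (wt w m <= wt w (s (dg m)))%N%:R.
  by rewrite /c' /= /alg_poly_eval hornerM hornerC hornerXn expr0n subn_eq0.
have nz m : (c' m != 0) = initial deg w P m.
  rewrite c'E; apply/idP/initialP => [c'0|[Pm mmin]].
    have Pm : P m by apply: contra_neq c'0 => ->; rewrite mulr0 mul0r.
    split=> // m' e Pm'; apply: leq_trans (smin _ _ (esym e) Pm').
    by apply: contraNT c'0 => /negPf->; rewrite mulr0.
  rewrite mmin //; last by case/initialP: (sin m).
  rewrite mulr1; apply/eqP => /(is_field_mulf_eq0 fK) u0; case/eqP: Pm; apply: u0.
  by apply: contra_neq (oner_neq0 K) => u0; rewrite -(us m) u0 mul0r.
exists c'; split=> //.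
- exact: coh_morph.
- move=> cb m; have u1 : u (dg m) = 1.
    have := us m; rewrite cb; case/initialP: (sin m) => Ps _.
    by rewrite -/(P _) Ps mulr1.
  rewrite c'E u1 mul1r [c m]cb -natrM mulnb.
  by case: (_ && _); rewrite ?oner_neq0 ?eqxx.
move=> Uc.
(* The fibre of [ct] at 1 is [c] up to a unit in each degree, and the fibre at 0 is [c'];
   [family_side] forbids them to be on different sides. *)
have [//|Vc'] := cover fK (cohX (coh_morph (alg_poly_eval 0) cct)).
case: (@family_side K ct 1 0 fK cct _ Vc').
suff -> : cohI deg (alg_poly_eval 1 \o ct) = cohI deg c by [].
apply: (@scale_cohI _ _ _ _ _ _ u) => m; first by exists (c (s (dg m))); rewrite mulrC.
by rewrite /= /alg_poly_eval hornerM hornerC hornerXn expr1n mulr1.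
Qed.

End Sides.

(** * Points over a field come from coefficient functions *)

Section FieldPoint.
Variables (G : zmodType) (n : nat) (deg : 'I_n -> G).
Notation mon := 'X_{1..n}.
Notation dg := (mon_degree deg).
Variables (K : comNzRingType) (fK : is_field K).
Variable I : {mpoly K[n]} -> Prop.
Hypothesis hI : is_homogeneous_ideal deg I.
Hypothesis lfI : forall b, locally_free_rank deg I b (semigroup_indicator deg b).

Let idI : is_ideal I := hI.1.

Lemma idealZ a p : I p -> I (a *: p).
Proof. by rewrite -mul_mpolyC; apply: idealM. Qed.

(** The [f s] generate the unit ideal, so one of them is nonzero; over a field it is invertible, and
    denominators can be removed from the local basis. *)
Lemma rank1_generator m : exists e : {mpoly K[n]},
  [/\ hcomp deg (dg m) e = e,
      forall p, hcomp deg (dg m) p = p -> exists a, I (p - a *: e)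
    & ~ I e].
Proof.
have [l [f [g [fg1 free]]]] := lfI (dg m).
have [s fs0] : exists s, f s != 0.
  apply: boolp.contrapT => no; move/eqP: fg1; apply/negP.
  rewrite big1 1?eq_sym ?oner_neq0 // => s _.
  have [->|fs0] := eqVneq (f s) 0; first by rewrite mulr0.
  by case: no; exists s.
have [y fy] := fK fs0.
have := free s; rewrite /semigroup_indicator.
case: boolp.asboolP => [_|[]]; last by exists m.
move=> [e [eh span indep]]; exists (e ord0); split=> [//|p /span[N [c]]|Ie].
  rewrite big_ord1 => Ip; exists (y ^+ N * c ord0).
  have := idealZ (y ^+ N) Ip; rewrite scalerBr !scalerA.
  by rewrite -exprMn_comm ?[y * _]mulrC ?fy ?expr1n ?scale1r //; apply: mulrC.
have [|N /(_ ord0)] := indep (fun _ => 1); first by rewrite big_ord1 scale1r.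
rewrite mulr1 => fN0; move/eqP: (oner_neq0 K); apply.
by rewrite -[LHS](expr1n _ N) -fy exprMn_comm ?fN0 ?mul0r //; apply: mulrC.
Qed.

Lemma idealZ_eq0 a p : ~ I p -> I (a *: p) -> a = 0.
Proof.
move=> nIp Ia; apply/eqP/negP => /negP/fK[y ay].
by apply: nIp; rewrite -[p]scale1r -ay mulrC -scalerA; apply: idealZ.
Qed.

(** In each degree some monomial lies outside [I] and therefore spans the quotient; [c m] is the
    coordinate of x^m on it. *)
Lemma field_point_cohI : exists2 c : mon -> K, coh deg c & I = cohI deg c.
Proof.
have std m : exists2 s, dg s = dg m &
    ~ I 'X_[s] /\ forall m', dg m' = dg m -> exists a, I ('X_[m'] - a *: 'X_[s]).
  have [e [eh span nIe]] := rank1_generator m.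
  have [s sm nIs] : exists2 s, dg s = dg m & ~ I 'X_[s].
    apply: boolp.contrapT => no; apply: nIe; rewrite -eh [hcomp _ _ _]mpolyE.
    apply: ideal_sum => // m'; rewrite mcoeff_msupp mcoeff_hcomp.
    case: (dg m' =P dg m) => [mm' _ _|_ /eqP[]//].
    by apply: idealZ; apply: boolp.contrapT => nI; apply: no; exists m'.
  exists s => //; split=> // m' mm'.
  have [|a1 Ia1] := span 'X_[m']; first by rewrite -mm' hcompX.
  have [|a2 Ia2] := span 'X_[s]; first by rewrite -sm hcompX.
  have [|y ay] := fK (x := a2).
    apply/eqP => a20; apply: nIs; move: Ia2.
    by rewrite a20 scale0r subr0.
  exists (a1 * y).
  have -> : 'X_[m'] - (a1 * y) *: 'X_[s] =
      ('X_[m'] - a1 *: e) - (a1 * y) *: ('X_[s] - a2 *: e).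
    rewrite scalerBr scalerA -mulrA [y * _]mulrC ay mulr1.
    by rewrite opprB addrA subrK.
  by apply: idealB => //; apply: idealZ.
have /boolp.choice[r rP] : forall b, exists s, (exists m, dg m = b) ->
    dg s = b /\ ~ I 'X_[s] /\
    forall m', dg m' = b -> exists a, I ('X_[m'] - a *: 'X_[s]).
  move=> b; have [[m <-]|no] := boolp.pselect (exists m, dg m = b); last first.
    by exists 0%MM.
  by have [s] := std m; exists s.
have rd m : dg (r (dg m)) = dg m by case: (rP (dg m)) => //; exists m.
have nIr m : ~ I 'X_[r (dg m)] by case: (rP (dg m)) => [|_ []//]; exists m.
have /boolp.choice[c cP] : forall m, exists a, I ('X_[m] - a *: 'X_[r (dg m)]).
  by move=> m; case: (rP (dg m)) => [|_ [_]]; [exists m | apply].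
have rr m : r (dg (r (dg m))) = r (dg m) by rewrite rd.
have c1 m : c (r (dg m)) = 1.
  apply/esym/eqP; rewrite -subr_eq0; apply/eqP/(idealZ_eq0 (nIr m)).
  by rewrite scalerBl scale1r; have := cP (r (dg m)); rewrite rr.
(* Both sides are the coordinate of x^(m + v) on the chosen monomial of its degree, which is not in
   [I]. *)
have cM m v : c (m + v)%MM = c m * c (r (dg m) + v)%MM.
  apply/eqP; rewrite -subr_eq0; apply/eqP/(idealZ_eq0 (nIr (m + v)%MM)).
  have I1 := cP (m + v)%MM.
  have I2 := idealM idI 'X_[v] (cP m).
  have := idealZ (c m) (cP (r (dg m) + v)%MM).
  have -> : dg (r (dg m) + v)%MM = dg (m + v)%MM by rewrite !mon_degreeD rd.
  move=> I3; have := idealB idI (idealD idI I2 I3) I1.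
  congr I; rewrite mulrBr -scalerAr -!mpolyXD ![(v + _)%MM]addmC.
  have cancel4 (x y z t : {mpoly K[n]}) : x - y + (y - z) - (x - t) = t - z by ring.
  by rewrite [_ *: (_ - _)]scalerBr scalerA cancel4 scalerBl.
have cc : coh deg c.
  split=> [m|m m' v e]; first by exists (r (dg m)).
  by rewrite (cM m v) (cM m' v) -e mulrCA.
exists c => //; apply: boolp.funext => p; apply: boolp.propext; split=> Ip.
  move=> b; have [[m mb]|no] := boolp.pselect (exists m, dg m = b); last first.
    by rewrite /ev big1 // => m /eqP mb; case: no; exists m.
  subst b; apply: (idealZ_eq0 (nIr m)).
  have -> : ev deg c (dg m) p *: 'X_[r (dg m)] = hcomp deg (dg m) p -
     \sum_(m' <- msupp p | dg m' == dg m) p@_m' *: ('X_[m'] - c m' *: 'X_[r (dg m')]).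
    rewrite /hcomp -sumrB scaler_suml; apply: eq_bigr => m' /eqP ->.
    by rewrite scalerBr opprB addrC subrK scalerA.
  apply: idealB => //; first exact: hI.2.
  by apply: ideal_sum => // m' _ _; apply: idealZ.
rewrite (cohI_expand rd Ip); apply: ideal_sum => // m _ _; exact: idealZ.
Qed.

End FieldPoint.

Section ScalarInclusion.
Variables (C : comNzRingType) (K : comAlgType C).

(** The structure map of [K] as a morphism of algebras; along it subfunctors carry points over [C]
    to points over [K]. *)
Definition scalar_incl (a : C^o) : K := a%:A.

Lemma scalar_incl_linear : linear scalar_incl.
Proof. by move=> a x y; rewrite /scalar_incl scalerDl scalerA. Qed.

Lemma scalar_incl_monoid_morphism : monoid_morphism scalar_incl.
Proof.
split=> [|x y]; first exact: scale1r.
by rewrite /scalar_incl -scalerAl mul1r scalerA.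
Qed.

HB.instance Definition _ :=
  GRing.isLinear.Build C C^o K *:%R scalar_incl scalar_incl_linear.
HB.instance Definition _ :=
  GRing.isMonoidMorphism.Build C^o K scalar_incl scalar_incl_monoid_morphism.

End ScalarInclusion.

(** * Reduction of connectedness to monomial sets *)

Section Connect.
Variables (C : numFieldType) (G : zmodType) (n : nat) (deg : 'I_n -> G).
Notation mon := 'X_{1..n}.
Notation dg := (mon_degree deg).

(** The standard monomials of a monomial ideal: [pcoh] supplies one in every degree that occurs, the
    second clause allows no other. *)
Definition monomial_set (S : mon -> bool) : Prop :=
  pcoh deg S /\ forall m m', dg m = dg m' -> S m -> S m' -> m = m'.

Lemma pcoh_initial w P : pcoh deg P -> pcoh deg (initial deg w P).
Proof.
move=> [P1 P2]; split=> [m|m m' v e /initialP[Pm mmin] /initialP[Pv vmin]].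
  have [s ds Ps] := P1 m; have [s' ds' is'] := initial_exists deg w Ps.
  by exists s'; rewrite // ds'.
have /andP[Pm' Pmv] := P2 _ _ _ e Pm Pv.
have ev : dg (m + v)%MM = dg (m' + v)%MM by rewrite !mon_degreeD e.
apply/andP; split; apply/initialP; split=> // m'' e'' Pm''.
  have /andP[_ P''] := P2 _ _ _ (etrans e'' erefl) Pm'' Pv.
  have := vmin (m'' + v)%MM; rewrite !mon_degreeD e'' => /(_ erefl P'').
  by rewrite !wtD leq_add2r.
apply: leq_trans (vmin _ _ Pm''); last by rewrite e''.
by rewrite !wtD leq_add2r mmin.
Qed.

Lemma coh_pcoh (K : comNzRingType) P :
  coh deg (chi K P) -> pcoh deg P.
Proof.
move=> [c1 c2]; split=> [m|m m' v e Pm Pv].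
  have [s ds cs] := c1 m; exists s => //; move/eqP: cs; rewrite /chi.
  by case: (P s); rewrite // eq_sym oner_eq0.
have /eqP := c2 _ _ v e; rewrite /chi Pm Pv mulr1 -natrM mulnb eq_sym.
by case: (_ && _); rewrite // eq_sym oner_eq0.
Qed.

Lemma regular_field : is_field (C^o : comAlgType C).
Proof. by move=> x x0; exists x^-1; apply: mulfV. Qed.

Section Sides.
Variable X : ideal_functor C n.
Hypothesis XE : forall (A : comAlgType C) (I : {mpoly A[n]} -> Prop),
  X I <-> multigraded_hilbert_scheme deg (semigroup_indicator deg) I.

Lemma cohX (A : comAlgType C) (c : mon -> A) : coh deg c -> X (cohI deg c).
Proof.
by move=> cc; apply/XE; split; [apply: cohI_homogeneous | apply: cohI_locally_free].
Qed.

Section UV.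
Variables U V : ideal_functor C n.
Hypotheses (oU : is_open_subfunctor X U) (oV : is_open_subfunctor X V).
Hypothesis disj : forall (K : comAlgType C) (I : {mpoly K[n]} -> Prop),
  is_field K -> ~ (U I /\ V I).
Hypothesis cover : forall (K : comAlgType C) (I : {mpoly K[n]} -> Prop),
  is_field K -> X I -> U I \/ V I.

Definition on_side (P : mon -> bool) := U (cohI deg (chi C^o P)).

Lemma on_side_initial w P :
  pcoh deg P -> on_side P -> on_side (initial deg w P).
Proof.
move=> cP UP.
have [c' [cc' c'E bc' Uc']] := degenerate cohX oU oV disj cover w regular_field
  (coh_chi C^o cP).
have chiE m : (chi C^o P m != 0) = P m.
  by rewrite /chi; case: (P m); rewrite ?oner_neq0 ?eqxx.
rewrite /on_side; suff -> : chi C^o (initial deg w P) = c' by apply: Uc'.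
apply: boolp.funext => m; rewrite bc' ?c'E /chi => [|m']; last by rewrite chiE.
congr ((initial deg w _ m)%:R); apply: boolp.funext => m'; exact: esym (chiE m').
Qed.

(** Minimising the exponent of each variable in turn leaves one monomial per degree. Its coefficient
    is then 1, so the ideal is defined over [C], and the point over [C] is on the same side as its
    base change to [K]. *)
Lemma field_point_side (K : comAlgType C) (I : {mpoly K[n]} -> Prop) :
  is_field K -> U I -> exists2 S, monomial_set S & on_side S.
Proof.
move=> fK UI; have /XE[hI lfI] := oU.1.1 _ _ UI.
have [c cc IE] := field_point_cohI fK hI lfI; subst I.
have [c' [cc' Uc' c'V]] : exists c' : mon -> K,
  [/\ coh deg c', U (cohI deg c') & forall m m', dg m = dg m' ->
    c' m != 0 -> c' m' != 0 -> forall v, v \in enum 'I_n -> m v = m' v].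
  elim: (enum 'I_n) => [|v s [c' [cc' Uc' c'V]]]; first by exists c.
  have [c'' [cc'' c''E _ Uc'']] :=
    degenerate cohX oU oV disj cover (delta_wt v) fK cc'.
  exists c''; split=> [//||m m' e]; first exact: Uc''.
  rewrite !c''E => /initialP[Pm mm] /initialP[Pm' mm'] i.
  rewrite inE => /orP[/eqP->|]; last exact: c'V.
  have := mm _ (esym e) Pm'; have := mm' _ e Pm; rewrite !wt_delta => le1 le2.
  by apply/eqP; rewrite eqn_leq le1 le2.
pose S m := c' m != 0.
have Suniq m m' : dg m = dg m' -> S m -> S m' -> m = m'.
  by move=> e Sm Sm'; apply/mnmP => v; apply: c'V => //; rewrite mem_enum.
have SE : c' = chi K S.
  apply: boolp.funext => m; rewrite /chi.
  have [c'm|c'm] := boolP (S m); last by apply/eqP; apply: contraNT c'm.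
  have [s ds c's] := cc'.1 m.
  by rewrite (Suniq m s) // /S c's oner_neq0.
have cS : pcoh deg S by apply: (@coh_pcoh K); rewrite -SE.
exists S => //; rewrite /on_side.
have [//|VS] := cover regular_field (cohX (coh_chi C^o cS)).
have := oV.1.2 C^o K (@scalar_incl C K) _ VS.
rewrite base_change_cohI; last exact: coh_chi.
rewrite chi_morph -SE => Vc'.
by case: (@disj K (cohI deg c') fK).
Qed.

End UV.

(** Conversely, if [P] were in [V], the forward direction with [U] and [V] exchanged would put the
    degeneration in [V] too. *)
Lemma on_side_initialE (U V : ideal_functor C n) :
  is_open_subfunctor X U -> is_open_subfunctor X V ->
  (forall (K : comAlgType C) (I : {mpoly K[n]} -> Prop),
    is_field K -> ~ (U K I /\ V K I)) ->
  (forall (K : comAlgType C) (I : {mpoly K[n]} -> Prop),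
    is_field K -> X I -> U K I \/ V K I) ->
  forall P w, pcoh deg P -> on_side U P <-> on_side U (initial deg w P).
Proof.
move=> oU oV disj cover P w cP; split; first exact: (on_side_initial oU oV).
have [//|VP Ui] := cover _ _ regular_field (cohX (coh_chi C^o cP)).
case: (disj C^o (cohI deg (chi C^o (initial deg w P))) regular_field).
split=> //; apply: (on_side_initial oV oU _ _ w cP VP) => L M fL.
  by move=> [VM UM]; apply: (disj L M).
by move/(cover _ _ fL) => []; [right | left].
Qed.

(** [Q] is applied to membership in [U] and in [V]. If both are nonempty, both contain the point of
    [xpredT], whose coefficient function is constantly 1, against disjointness. *)
Lemma connected_of_degenerations :
  (forall Q : (mon -> bool) -> Prop,
    (forall P w, pcoh deg P -> Q P <-> Q (initial deg w P)) ->
    forall S, monomial_set S -> Q S -> Q xpredT) ->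
  is_connected X.
Proof.
move=> link.
have cT : pcoh deg xpredT by split=> // m; exists m.
split.
  exists C^o, (cohI deg (chi C^o xpredT)); split; first exact: regular_field.
  exact: cohX (coh_chi _ cT).
move=> U V oU oV cover disj.
have [[K [I [fK UI]]]|noU] := boolp.pselect (exists (K : comAlgType C)
  (I : {mpoly K[n]} -> Prop), is_field K /\ U K I); last first.
  by left=> K I fK UI; apply: noU; exists K, I.
right=> K' I' fK' VI'.
have cover' (L : comAlgType C) (M : {mpoly L[n]} -> Prop) :
    is_field L -> X M -> V L M \/ U L M.
  by move=> fL /(cover _ _ fL) []; [right | left].
have disj' (L : comAlgType C) (M : {mpoly L[n]} -> Prop) :
    is_field L -> ~ (V L M /\ U L M).
  by move=> fL [VM UM]; apply: (disj L M).
have [S mS US] := field_point_side oU oV disj cover fK UI.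
have [S' mS' VS'] := field_point_side oV oU disj' cover' fK' VI'.
apply: (disj C^o (cohI deg (chi C^o xpredT)) regular_field); split.
  exact: link (on_side_initialE oU oV disj cover) _ mS US.
exact: link (on_side_initialE oV oU disj' cover') _ mS' VS'.
Qed.

End Sides.
End Connect.

(** * Flips of monomial sets *)

(* The flip exchanging al and be.  Adding to S the monomials obtained from it
   by replacing powers of al by powers of be gives a set having both S and the
   flipped set among its degenerations, provided these monomials are closed
   under division; that is what [link] says. *)
Section Flip.
Variables (G : zmodType) (n : nat) (deg : 'I_n -> G).
Notation mon := 'X_{1..n}.
Notation dg := (mon_degree deg).

Lemma pcoh_divisor P m m' : pcoh deg P -> P (m + m')%MM -> P m.
Proof.
move=> [P1 P2] Pmm; have [s ds Ps] := P1 m.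
by have /andP[] := P2 _ _ _ ds Ps Pmm.
Qed.

(** The variables of [v] are added one at a time; closure under division keeps the intermediate
    monomials in [P]. *)
Lemma pcoh_step (P : mon -> bool) :
  (forall m, exists2 s, dg s = dg m & P s) ->
  (forall m i, P (m + U_(i))%MM -> P m) ->
  (forall m m' i, dg m = dg m' -> P m -> P m' -> P (m' + U_(i))%MM ->
    P (m + U_(i))%MM) ->
  pcoh deg P.
Proof.
move=> P1 Pd Ps; split=> // m m' v.
have [N] := ubnP (mdeg v); elim: N v => // N IHN v ltN e Pm Pv.
have [v0|] := eqVneq v 0%MM; first by move: Pv; rewrite v0 !addm0 Pm => ->.
rewrite -mdeg_eq0 mdegE sum_nat_eq0 negb_forall => /existsP[i /= vi].
have vE : v = ((v - U_(i)) + U_(i))%MM by rewrite submK // lep1mP.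
move: Pv ltN; rewrite vE !addmA mdegD mdeg1 addn1 ltnS => Pv ltN.
have /andP[-> Pm1] := IHN _ ltN e Pm (Pd _ _ Pv).
apply: Ps Pm1 (Pd _ _ Pv) Pv.
by rewrite !mon_degreeD e.
Qed.

Lemma mon_degreeMn (m : mon) k : dg (m *+ k)%MM = dg m *+ k.
Proof.
rewrite /mon_degree -sumrMnl; apply: eq_bigr => i _.
by rewrite mulmnE mulrnA.
Qed.

Variables (S : mon -> bool) (al be : mon) (u v : 'I_n).
Hypotheses (mS : monomial_set deg S) (dab : dg al = dg be).
Hypotheses (alu : al u != 0%N) (bev : be v != 0%N).
Hypotheses (disj : forall i, al i = 0%N \/ be i = 0%N) (Sal : S al).
Hypothesis link : forall (g : mon) i, be i != 0%N -> g i = 0%N ->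
  S (g + al)%MM -> S (g + be - U_(i))%MM.

Definition flip_set (m : mon) : bool :=
  boolp.asbool (exists g k, m = (g + be *+ k)%MM /\ S (g + al *+ k)%MM).

Lemma dg_flip (g : mon) k : dg (g + be *+ k)%MM = dg (g + al *+ k)%MM.
Proof. by rewrite !mon_degreeD !mon_degreeMn dab. Qed.

Lemma nSbe m : S (be + m)%MM = false.
Proof.
apply/negP => /(pcoh_divisor mS.1) Sbe.
have /mnmP/(_ u) := mS.2 _ _ dab Sal Sbe; case: (disj u) => e.
  by move: alu; rewrite e.
by rewrite e => /eqP; rewrite (negPf alu).
Qed.

Lemma sub_flip_set m : S m -> flip_set m.
Proof.
by move=> Sm; apply/boolp.asboolP; exists m, 0%N; rewrite !mulm0n !addm0.
Qed.

Lemma mnm_leD (m m' : mon) : (m <= m')%MM -> m' = (m + (m' - m))%MM.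
Proof. by move=> le; rewrite addmC submK. Qed.

(** A variable of [g] is removed from [g]. Any other one divides [be]: one copy of [be] is then
    opened, and [link] lets what remains of it join [g]. *)
Lemma flip_set_divisor m i : flip_set (m + U_(i))%MM -> flip_set m.
Proof.
move=> /boolp.asboolP[g [k [E Sg]]]; apply/boolp.asboolP.
have Ej j : (m j + (i == j) = g j + be j * k)%N.
  by have /mnmP/(_ j) := E; rewrite !mnmDE mulmnE mnm1E.
have [gi0|gi] := eqVneq (g i) 0%N; last first.
  exists (g - U_(i))%MM, k; split.
    apply/mnmP => j; rewrite mnmDE mnmBE mulmnE mnm1E; have := Ej j.
    by case: eqP => [<-|_] /=; lia.
  apply: (pcoh_divisor (m' := U_(i)) mS.1); move: Sg; congr S.
  apply/mnmP => j; rewrite !mnmDE !mulmnE mnmBE mnm1E.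
  by case: eqP => [<-|_] /=; lia.
case: k E Sg Ej => [|k] E Sg Ej; first by have := Ej i; rewrite eqxx; lia.
have bei : be i != 0%N by apply/eqP => b0; have := Ej i; rewrite eqxx gi0 b0; lia.
have ali : al i = 0%N by case: (disj i) => // b0; rewrite b0 in bei.
exists (g + be - U_(i))%MM, k; split.
  apply/mnmP => j; rewrite mnmDE mnmBE mnmDE mulmnE mnm1E; have := Ej j.
  by case: eqP => [<-|_] /=; rewrite mulnS; lia.
have := link (g := (g + al *+ k)%MM) bei; rewrite mnmDE mulmnE gi0 ali mul0n.
rewrite -addmA -mulmSr => /(_ erefl Sg); congr S.
apply/mnmP => j; rewrite !(mnmDE, mnmBE, mulmnE) mnm1E.
by case: eqP => [<-|_] /=; lia.
Qed.

Lemma flip_set_step m m' i : dg m = dg m' -> flip_set m -> flip_set m' ->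
  flip_set (m' + U_(i))%MM -> flip_set (m + U_(i))%MM.
Proof.
move=> e /boolp.asboolP[g [k [Em Sg]]] /boolp.asboolP[g' [k' [Em' Sg']]].
move=> /boolp.asboolP[h [q [E Sh]]]; apply/boolp.asboolP.
have Es : (g + al *+ k = g' + al *+ k')%MM.
  by apply: mS.2 => //; rewrite -!dg_flip -Em -Em'.
have Esj j : (g j + al j * k = g' j + al j * k')%N.
  by have /mnmP/(_ j) := Es; rewrite !mnmDE !mulmnE.
have Ej j : (g' j + be j * k' + (i == j) = h j + be j * q)%N.
  by have /mnmP/(_ j) := E; rewrite Em' !mnmDE !mulmnE mnm1E.
have nle (g0 : mon) k0 : S (g0 + al *+ k0)%MM -> ~ (be <= g0)%MM.
  by move=> S0 /mnm_leD E0; move: S0; rewrite E0 -addmA nSbe.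
(* Neither [g'] nor [h] is divisible by [be], so one more variable completes at most one further
   copy of [be]: [q] is [k'] or [k'.+1]. *)
have leq : (k' <= q)%N.
  rewrite leqNgt; apply/negP => lt; apply: (nle _ _ Sh); apply/mnm_lepP => j.
  have := Ej j; rewrite -(subnKC lt) mulnDr mulnS; lia.
have geq : (q <= k'.+1)%N.
  rewrite leqNgt; apply/negP => lt; apply: (nle _ _ Sg'); apply/mnm_lepP => j.
  by have := Ej j; rewrite -(subnKC lt) !mulnDr !mulnS; case: eqP => _ /=; lia.
have [qk|qk] : q = k' \/ q = k'.+1 by lia.
  subst q; exists (g + U_(i))%MM, k; split.
    by apply/mnmP => j; rewrite Em !mnmDE; lia.
  move: Sh; congr S; apply/mnmP => j.
  by rewrite !mnmDE !mulmnE mnm1E; have := Ej j; have := Esj j; lia.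
(* Here [g' + U_(i) = h + be]. The power of [al] by which [g] and [g'] differ is put into [h] or
   taken out of it; in the second case [h] is divisible by it because [al] and [be] share no
   variable. *)
subst q; have [kk|/ltnW kk] := leqP k k'.
  rewrite -(subnKC kk) in Esj Ej Sh; move: (k' - k)%N Esj Ej Sh => d Esj Ej Sh.
  exists (h + al *+ d)%MM, k.+1; split.
    apply/mnmP => j; rewrite Em !mnmDE !mulmnE mnm1E mulnS.
    by have := Ej j; have := Esj j; rewrite mulnS !mulnDr; lia.
  move: Sh; congr S; apply/mnmP => j.
  by rewrite !mnmDE !mulmnE !mulnS !mulnDr; lia.
rewrite -(subnKC kk) in Esj Em Sg; move: (k - k')%N Esj Em Sg => d Esj Em Sg.
have hj j : (al j * d <= h j)%N.
  have := Ej j; have := Esj j; rewrite mulnDr mulnS.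
  by case: (disj j) => ->; lia.
exists (h - al *+ d)%MM, (k' + d).+1; split.
  apply/mnmP => j; rewrite Em !mnmDE !mulmnE mnm1E mnmBE mulmnE mulnS !mulnDr.
  by have := hj j; have := Ej j; have := Esj j; rewrite mulnS !mulnDr; lia.
move: Sh; congr S; apply/mnmP => j; have := hj j.
by rewrite !mnmDE !mulmnE mnmBE mulmnE !mulnS !mulnDr; lia.
Qed.

Lemma pcoh_flip_set : pcoh deg flip_set.
Proof.
apply: pcoh_step; [|exact: flip_set_divisor|exact: flip_set_step].
by move=> m; have [s ds Ss] := mS.1.1 m; exists s => //; apply: sub_flip_set.
Qed.

Lemma flip_setP m : flip_set m -> exists g k,
  m = (g + be *+ k)%MM /\ S (g + al *+ k)%MM.
Proof. by move/boolp.asboolP. Qed.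

(** The variable [v] occurs in [be] and not in [al], so minimising its exponent forbids every
    replacement. *)
Lemma initial_flip_set_src : initial deg (delta_wt v) flip_set = S.
Proof.
have alv : al v = 0%N by case: (disj v) => // b0; move: bev; rewrite b0.
apply: boolp.funext => m; apply/initialP/idP => [[/flip_setP[g [k [-> Sg]]] mmin]|Sm].
  case: k mmin Sg => [|k] mmin Sg; first by move: Sg; rewrite !mulm0n.
  have := mmin _ (esym (dg_flip _ _)) (sub_flip_set Sg).
  rewrite !wt_delta !mnmDE !mulmnE alv mul0n addn0 mulnS.
  by move: bev; lia.
split; first exact: sub_flip_set.
move=> m' e /flip_setP[g [k [Em' Sg]]]; rewrite Em' in e *; rewrite !wt_delta.
have -> : m = (g + al *+ k)%MM by apply: mS.2; rewrite // -dg_flip.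
by rewrite !mnmDE !mulmnE alv mul0n; lia.
Qed.

(** Minimising the exponent of [u], which occurs in [al] and not in [be], replaces as many powers of
    [al] as possible. [Q] passes from [S] to the result because both are degenerations of
    [flip_set]. *)
Lemma flip_exists : exists S',
  [/\ monomial_set deg S', S' be, forall m, S m -> ~~ (al <= m)%MM -> S' m
    & forall Q : (mon -> bool) -> Prop,
      (forall P w, pcoh deg P -> Q P <-> Q (initial deg w P)) -> Q S -> Q S'].
Proof.
have beu : be u = 0%N by case: (disj u) => // a0; move: alu; rewrite a0.
exists (initial deg (delta_wt u) flip_set); split.
- split=> [|m m' e /initialP[Pm mm] /initialP[Pm' mm']].
    exact: pcoh_initial pcoh_flip_set.
  have := mm _ (esym e) Pm'; have := mm' _ e Pm; rewrite !wt_delta.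
  case/flip_setP: Pm => g [k [Em Sg]]; case/flip_setP: Pm' => g' [k' [Em' Sg']].
  have Es : (g + al *+ k = g' + al *+ k')%MM.
    by apply: mS.2 => //; rewrite -!dg_flip -Em -Em'.
  have /mnmP/(_ u) := Es; rewrite Em Em' !mnmDE !mulmnE beu !mul0n !addn0.
  move=> E le1 le2; have {}le : g u = g' u by lia.
  have kk : k = k'.
    by apply/eqP; move/eqP: E; rewrite le eqn_add2l eqn_mul2l (negPf alu).
  by subst k'; congr (_ + _)%MM; apply: addIm Es.
- apply/initialP; split.
    apply/boolp.asboolP; exists 0%MM, 1%N; rewrite !add0m.
    by rewrite !mulm1n.
  by move=> m _ _; rewrite !wt_delta beu.
- move=> m Sm nal; apply/initialP; split; first exact: sub_flip_set.
  move=> m' e /flip_setP[g [k [Em' Sg]]]; rewrite Em' in e *; rewrite !wt_delta.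
  have E : m = (g + al *+ k)%MM by apply: mS.2; rewrite // -dg_flip.
  case: k E {Em'} Sg e => [|k] E Sg e; first by rewrite E !mulm0n.
  case/negP: nal; apply/mnm_lepP => j; rewrite E mnmDE mulmnE mulnS; lia.
- move=> Q inv QS; apply/(inv _ _ pcoh_flip_set)/(inv _ (delta_wt v)) => //; first exact: pcoh_flip_set.
  by rewrite initial_flip_set_src.
Qed.

End Flip.

(** * Compatible column sets and their behaviour under flips *)

(* Three rows seen through the ranks p, q, r of the columns for the orders of
   the row pairs 12, 13, 23, and through the standard cubics tr a b c, standing
   for x_1a x_2b x_3c; Gi is the set of columns of the variables of row i that
   divide a monomial, which is standard iff G1, G2, G3 are compatible. *)
Section Compatible.
Local Open Scope nat_scope.
Variable T : eqType.
Variables (p q r : T -> nat) (tr : T -> T -> T -> bool).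
Hypotheses (p_inj : injective p) (q_inj : injective q) (r_inj : injective r).

Hypothesis tr_pairs : forall a b c, a != b -> b != c -> a != c -> tr a b c ->
  [/\ p a < p b, q a < q c & r b < r c].
Hypothesis tr_ex : forall a b c, a != b -> b != c -> a != c ->
  p a < p b -> q a < q c -> r b < r c -> [|| tr a b c, tr b c a | tr c a b].

Record compatible (G1 G2 G3 : T -> Prop) : Prop := Compatible {
  compat12 : forall a b, G1 a -> G2 b -> p a <= p b;
  compat13 : forall a c, G1 a -> G3 c -> q a <= q c;
  compat23 : forall b c, G2 b -> G3 c -> r b <= r c;
  compat123 : forall a b c, a != b -> b != c -> a != c ->
    G1 a -> G2 b -> G3 c -> tr a b c }.

Definition adjoin (x : T) (X : T -> Prop) (y : T) : Prop := y = x \/ X y.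

Lemma neq_p a b : a != b -> p a != p b. Proof. by rewrite (inj_eq p_inj). Qed.
Lemma neq_q a b : a != b -> q a != q b. Proof. by rewrite (inj_eq q_inj). Qed.
Lemma neq_r a b : a != b -> r a != r b. Proof. by rewrite (inj_eq r_inj). Qed.

(** The column [k] is the h of the overview. Minimality of h gives [sorted_below]; maximality of [j]
    then gives [adjacent]. *)
Variables j k : T.
Hypotheses (qkj : q k < q j) (rjk : r j < r k).
Hypothesis sorted_below : forall l x,
  (q l < q k) ==> (q l < q x) ==> (r l < r x).
Hypothesis adjacent : forall x, ~~ (r j < r x < r k).

Ltac ranks := move=> *; try lia;
  repeat match goal with H : is_true (?a != ?b) |- _ =>
  move: (neq_p H) (neq_q H) (neq_r H); clear H end; lia.

Lemma tr_lt a b c : a != b -> b != c -> a != c -> tr a b c ->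
  [&& p a < p b, q a < q c & r b < r c].
Proof. by move=> ab bc ac /(tr_pairs ab bc ac)[-> -> ->]. Qed.

(** By [tr_ex] one of the three cyclic rotations is standard, so it suffices that the pair relations
    forced by the other two fail. *)
Lemma tr_of a b c : a != b -> b != c -> a != c ->
  p a <= p b -> q a <= q c -> r b <= r c ->
  (tr b c a -> ~~ [&& p b < p c, q b < q a & r c < r a]) ->
  (tr c a b -> ~~ [&& p c < p a, q c < q b & r a < r b]) -> tr a b c.
Proof.
move=> ab bc ac pab qac rbc n1 n2.
case/or3P: (@tr_ex a b c ab bc ac ltac:(ranks) ltac:(ranks) ltac:(ranks)) => // t.
  by have := n1 t; rewrite tr_lt // eq_sym.
by have := n2 t; rewrite tr_lt // eq_sym.
Qed.

Lemma k_neq_j : k != j.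
Proof. by apply: contraTneq qkj => ->; lia. Qed.

Section QuadricFlip.
Hypothesis no_cubic : forall l, l != j -> l != k -> tr l j k -> p l < p k.
Variables G1 G2 G3 : T -> Prop.
Hypothesis GG : compatible G1 (adjoin j G2) (adjoin k G3).

Let G1k a : G1 a -> q a <= q k.
Proof. by move=> G1a; apply: (compat13 GG) => //; left. Qed.

Let G1j a : G1 a -> p a <= p j.
Proof. by move=> G1a; apply: (compat12 GG) => //; left. Qed.

Let G1_neq_j a : G1 a -> a != j.
Proof. by move=> /G1k; apply: contraTneq => ->; lia. Qed.

Let G2k b : G2 b -> r b <= r k.
Proof. by move=> G2b; apply: (compat23 GG); [right|left]. Qed.

Let G3j c : G3 c -> r j <= r c.
Proof. by move=> G3c; apply: (compat23 GG); [left|right]. Qed.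

(** This is [link] when x_3j is removed from x_2k x_3j. The new pairs come from [no_cubic] and
    adjacency. Against a cubic [a], [k], [c], the rotation [tr k c a] needs [q k < q a], and
    [tr c a k] needs [q c < q k], hence [r c < r j] by sortedness; both are impossible. *)
Lemma quadric_flip_k : ~ G3 j -> compatible G1 (adjoin k G2) G3.
Proof.
move=> nj; have G3_neq_j c : G3 c -> c != j by move=> G3c; apply/eqP => e; rewrite e in G3c.
have c12 a b : G1 a -> adjoin k G2 b -> p a <= p b.
  move=> G1a [->|G2b]; last by apply: (compat12 GG) => //; right.
  have [->//|ak] := eqVneq a k; have aj := G1_neq_j G1a.
  by apply/ltnW/no_cubic => //; apply: (compat123 GG) => //;
    rewrite 1?eq_sym ?k_neq_j //; left.
have c13 a c : G1 a -> G3 c -> q a <= q c.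
  by move=> G1a G3c; apply: (compat13 GG) => //; right.
have c23 b c : adjoin k G2 b -> G3 c -> r b <= r c.
  move=> [->|G2b] G3c; last by apply: (compat23 GG); right.
  have [->//|ck] := eqVneq c k.
  have := G3j G3c; have := @adjacent c; have := G3_neq_j _ G3c; ranks.
split=> // a b c ab bc ac G1a [bk|G2b] G3c; last first.
  by apply: (compat123 GG) => //; right.
have pab := c12 a b G1a (or_introl bk); have qac := c13 a c G1a G3c.
have rbc := c23 b c (or_introl bk) G3c; subst b.
have := sorted_below c j; have := G3j G3c; have := G3_neq_j _ G3c.
have := G1k G1a; move=> *.
by apply: tr_of => // _; ranks.
Qed.

(** This is [link] when x_2k is removed. The rotation [tr b j a] is excluded by [no_cubic] if
    [a = k] and by sortedness otherwise; [tr j a b] needs [p j < p a]. *)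
Lemma quadric_flip_j : ~ G2 k -> compatible G1 G2 (adjoin j G3).
Proof.
move=> nk; have G2_neq_k b : G2 b -> b != k by move=> G2b; apply/eqP => e; rewrite e in G2b.
have c12 a b : G1 a -> G2 b -> p a <= p b.
  by move=> G1a G2b; apply: (compat12 GG) => //; right.
have c13 a c : G1 a -> adjoin j G3 c -> q a <= q c.
  move=> G1a [->|G3c]; first by have := G1k G1a; ranks.
  by apply: (compat13 GG) => //; right.
have c23 b c : G2 b -> adjoin j G3 c -> r b <= r c.
  move=> G2b [->|G3c]; last by apply: (compat23 GG); right.
  by have := G2k G2b; have := @adjacent b; have := G2_neq_k _ G2b; ranks.
split=> // a b c ab bc ac G1a G2b [cj|G3c]; last first.
  by apply: (compat123 GG) => //; right.
have pab := c12 a b G1a G2b; have qac := c13 a c G1a (or_introl cj).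
have rbc := c23 b c G2b (or_introl cj); subst c.
have := G1k G1a; have := G1j G1a; have := G2_neq_k _ G2b.
have := sorted_below a j; move=> *.
apply: tr_of => // [t|_]; last by ranks.
have [ak|ak] := eqVneq a k; last by ranks.
by rewrite ak in t pab *; have := no_cubic bc (G2_neq_k _ G2b) t; ranks.
Qed.

End QuadricFlip.

Section CubicFlip.
Variable l : T.
Hypotheses (lj : l != j) (lk : l != k) (trl : tr l j k) (pkl : p k < p l).
Hypothesis l_max : forall x, x != j -> x != k -> tr x j k -> p x <= p l.
Variables G1 G2 G3 : T -> Prop.
Hypothesis GG : compatible (adjoin l G1) (adjoin j G2) (adjoin k G3).

Let l_pairs : [/\ p l < p j, q l < q k & r j < r k].
Proof. by apply: tr_pairs => //; rewrite eq_sym k_neq_j. Qed.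

Let G1p a : G1 a -> p a <= p j.
Proof. by move=> G1a; apply: (compat12 GG); [right | left]. Qed.

Let G1q a : G1 a -> q a <= q k.
Proof. by move=> G1a; apply: (compat13 GG); [right | left]. Qed.

Let G1_neq_j a : G1 a -> a != j.
Proof. by move=> /G1q; apply: contraTneq => ->; lia. Qed.

Let G1l a : G1 a -> p a <= p l.
Proof.
move=> G1a; have aj := G1_neq_j G1a.
have [->|ak] := eqVneq a k; first exact: ltnW.
apply: l_max => //; apply: (compat123 GG) => //; rewrite 1?eq_sym ?k_neq_j //;
  by [left | right].
Qed.

Let G2p b : G2 b -> p l <= p b.
Proof. by move=> G2b; apply: (compat12 GG); [left | right]. Qed.

Let G2r b : G2 b -> r b <= r j.
Proof.
move=> G2b; have : r b <= r k by apply: (compat23 GG); [right | left].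
have bk : b != k by move: (G2p G2b); apply: contraTneq => ->; lia.
have := @adjacent b; ranks.
Qed.

Let G3l c : G3 c -> q l < q c /\ r l < r c.
Proof.
move=> G3c; have : q l <= q c by apply: (compat13 GG); [left | right].
have : r j <= r c by apply: (compat23 GG); [left | right].
have [_ qlk _] := l_pairs.
have := sorted_below l j; have := sorted_below l c.
have [->|cl] := eqVneq c l; first by lia.
by ranks.
Qed.

Let G3k c : G3 c -> q k <= q c.
Proof.
move=> G3c; have : r j <= r c by apply: (compat23 GG); [left | right].
by have := sorted_below c j; lia.
Qed.

Let G3r c : G3 c -> c != j -> r k <= r c.
Proof.
move=> G3c; have : r j <= r c by apply: (compat23 GG); [left | right].
have := @adjacent c; ranks.
Qed.

Let c12 a b : adjoin k G1 a -> adjoin l G2 b -> p a <= p b.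
Proof.
move=> [->|G1a] [->|G2b]; first exact: ltnW.
- by have := G2p G2b; lia.
- exact: G1l.
- by apply: (compat12 GG); right.
Qed.

Let c13 a c : adjoin k G1 a -> adjoin j G3 c -> q a <= q c.
Proof.
move=> [->|G1a] [->|G3c]; first exact: ltnW.
- exact: G3k.
- by have := G1q G1a; lia.
- by apply: (compat13 GG); right.
Qed.

Let c23 b c : adjoin l G2 b -> adjoin j G3 c -> r b <= r c.
Proof.
have [_ qlk _] := l_pairs; have := sorted_below l j.
move=> rlj [->|G2b] [->|G3c]; first by lia.
- by case: (G3l G3c); lia.
- exact: G2r.
- by apply: (compat23 GG); right.
Qed.

(** The only cubic left out is x_1k x_2l x_3j, a rotation of the standard x_1l x_2j x_3k; omitting
    any one of its variables yields the three lemmas that follow. For [a = k] and [c = j],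
    maximality of [l] excludes the rotation [tr b j k], which would force [b = l]. *)
Let c123 a b c : a != b -> b != c -> a != c ->
  adjoin k G1 a -> adjoin l G2 b -> adjoin j G3 c ->
  ~ (a = k /\ b = l /\ c = j) ->
  tr a b c.
Proof.
move=> ab bc ac G1a G2b G3c ne.
have pab := c12 G1a G2b; have qac := c13 G1a G3c; have rbc := c23 G2b G3c.
have [plj qlk _] := l_pairs; have rlj := sorted_below l j.
have [ak|ak] := eqVneq a k.
  subst a; apply: tr_of => // [t|_]; last first.
    by case: G2b => [->|/G2r]; ranks.
  have [cj|cj] := eqVneq c j; last first.
    by case: G3c => [/eqP|/G3r/(_ cj)]; [rewrite (negPf cj) | ranks].
  subst c; have [bl|bl] := eqVneq b l; first by case: ne.
  case: G2b => [/eqP|G2b]; first by rewrite (negPf bl).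
  by have := G2p G2b; have := l_max bc _ t; rewrite eq_sym => /(_ ab); ranks.
case: G1a => [/eqP|G1a]; first by rewrite (negPf ak).
case: (G2b) (G3c) => [bl|G2b'] [cj|G3c']; last first.
- by apply: (compat123 GG) => //; right.
- by have := G1p G1a; have := G1q G1a; have := sorted_below a c;
    subst c; move=> *; apply: tr_of => // _; ranks.
- by have := G3l G3c'; have := G1q G1a; have := sorted_below a c;
    subst b; move=> *; apply: tr_of => // _; ranks.
- by have := G1p G1a; have := G1q G1a; have := sorted_below a c;
    subst c; move=> *; apply: tr_of => // _; ranks.
Qed.

Lemma cubic_flip_j : ~ G3 j -> compatible (adjoin k G1) (adjoin l G2) G3.
Proof.
move=> nj; split=> [//|a c|b c|a b c ab bc ac] Xa Yc.
- by apply: c13 => //; right.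
- by apply: c23 => //; right.
- by move=> Gc; apply: c123 => //; [right | case=> _ [_ cj]; rewrite cj in Gc].
Qed.

Lemma cubic_flip_l : ~ G2 l -> compatible (adjoin k G1) G2 (adjoin j G3).
Proof.
move=> nl; split=> [a b|//|b c|a b c ab bc ac] Xa Yc.
- by apply: c12 => //; right.
- by apply: c23 => //; right.
- by move=> Gc; apply: c123 => //; [right | case=> _ [bl _]; rewrite bl in Yc].
Qed.

Lemma cubic_flip_k : ~ G1 k -> compatible G1 (adjoin l G2) (adjoin j G3).
Proof.
move=> nk; split=> [a b|a c|//|a b c ab bc ac] Xa Yc.
- by apply: c12 => //; right.
- by apply: c13 => //; right.
- by move=> Gc; apply: c123 => //; [right | case=> ak _; rewrite ak in Xa].
Qed.

End CubicFlip.
End Compatible.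

(** * Monomials in the matrix entries, with their row and column sums *)

Section Segre.
Variables (d k : nat).
Notation mon := 'X_{1..(d * k)}.
Notation dg := (mon_degree (@segre_deg d k)).
Notation ix := (@mxvec_index d k).

Definition xv (i : 'I_d) (a : 'I_k) : mon := U_(ix i a)%MM.

Lemma ix_inj i a j b : (ix i a == ix j b) = (i == j) && (a == b).
Proof.
case: (curry_mxvec_bij d k) => g gK _.
apply/eqP/andP => [e|[/eqP-> /eqP->]//].
have gE x : g (uncurry ix x) = x by apply: gK.
by have := gE (i, a); rewrite /= e -[ix j b]/(uncurry ix (j, b)) gE => -[-> ->].
Qed.

Lemma xvE i a j b : xv i a (ix j b) = ((i == j) && (a == b)) :> nat.
Proof. by rewrite mnm1E ix_inj. Qed.

Lemma dg_xv i a : dg (xv i a) = (delta_mx 0 i, delta_mx 0 a).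
Proof.
rewrite /mon_degree (bigD1 (ix i a)) //= mnm1E eqxx mulr1n segre_degE.
rewrite big1 ?addr0 // => v vN; rewrite mnm1E eq_sym.
by case: eqP vN => // _ _; rewrite mulr0n.
Qed.

Lemma dg_swap i i' a b (g : mon) :
  dg (xv i a + xv i' b + g)%MM = dg (xv i b + xv i' a + g)%MM.
Proof.
rewrite !mon_degreeD !dg_xv; congr (_ + _).
by congr (_, _) => /=; rewrite addrC.
Qed.

Lemma sum_mxvec (V : nmodType) (F : 'I_(d * k) -> V) :
  \sum_v F v = \sum_i \sum_a F (ix i a).
Proof.
rewrite pair_bigA /= (reindex _ (curry_mxvec_bij d k)).
by apply: eq_bigr => -[].
Qed.

Lemma dg_rowE (m : mon) i : (dg m).1 0 i = (\sum_a m (ix i a))%N%:Z.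
Proof.
have fstD : {morph (fun x : 'rV[int]_d * 'rV[int]_k => x.1 0 i) : x y / x + y}.
  by move=> x y; rewrite /= mxE.
have fst0 : (0 : 'rV[int]_d * 'rV[int]_k).1 0 i = 0 by rewrite mxE.
have fstMn (x : 'rV[int]_d * 'rV[int]_k) n : (x *+ n).1 0 i = x.1 0 i *+ n.
  by elim: n => [|n IHn]; rewrite ?mulr0n // !mulrS fstD IHn.
rewrite /mon_degree (big_morph _ fstD fst0) sum_mxvec (bigD1 i) //=.
rewrite [X in _ + X]big1 ?addr0 => [|j ji].
  rewrite (big_morph Posz PoszD (erefl _)); apply: eq_bigr => a _.
  by rewrite fstMn segre_degE mxE !eqxx /= [LHS]natz.
by apply: big1 => a _; rewrite fstMn segre_degE mxE eqxx [i == j]eq_sym (negPf ji) mul0rn.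
Qed.

Lemma dg_colE (m : mon) a : (dg m).2 0 a = (\sum_i m (ix i a))%N%:Z.
Proof.
have sndD : {morph (fun x : 'rV[int]_d * 'rV[int]_k => x.2 0 a) : x y / x + y}.
  by move=> x y; rewrite /= mxE.
have snd0 : (0 : 'rV[int]_d * 'rV[int]_k).2 0 a = 0 by rewrite mxE.
have sndMn (x : 'rV[int]_d * 'rV[int]_k) n : (x *+ n).2 0 a = x.2 0 a *+ n.
  by elim: n => [|n IHn]; rewrite ?mulr0n // !mulrS sndD IHn.
rewrite /mon_degree (big_morph _ sndD snd0) sum_mxvec exchange_big (bigD1 a) //=.
rewrite [X in _ + X]big1 ?addr0 => [|b ba].
  rewrite (big_morph Posz PoszD (erefl _)); apply: eq_bigr => i _.
  by rewrite sndMn segre_degE mxE !eqxx /= [LHS]natz.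
by apply: big1 => i _; rewrite sndMn segre_degE mxE eqxx [a == b]eq_sym (negPf ba) mul0rn.
Qed.

Lemma sum_gt_exists (I : finType) (F F' : I -> nat) i :
  (\sum_j F j = \sum_j F' j)%N -> (F' i < F i)%N -> exists j, (F j < F' j)%N.
Proof.
move=> e lt; apply: boolp.contrapT => no.
have le j : (F' j <= F j)%N by rewrite leqNgt; apply/negP => ?; apply: no; exists j.
have : (\sum_j F' j < \sum_j F j)%N.
  rewrite (bigD1 i) //= [X in (_ < X)%N](bigD1 i) //= -addSn leq_add //.
  by apply: leq_sum.
by rewrite e ltnn.
Qed.

Lemma row_exchange (m m' : mon) i a : dg m = dg m' ->
  (m' (ix i a) < m (ix i a))%N -> exists b, (m (ix i b) < m' (ix i b))%N.
Proof.
move=> e; apply: (@sum_gt_exists _ (fun a => m (ix i a)) (fun a => m' (ix i a))).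
by apply: (can_inj absz_nat); rewrite -!dg_rowE e.
Qed.

Lemma col_exchange (m m' : mon) i a : dg m = dg m' ->
  (m' (ix i a) < m (ix i a))%N -> exists j, (m (ix j a) < m' (ix j a))%N.
Proof.
move=> e; apply: (@sum_gt_exists _ (fun i => m (ix i a)) (fun i => m' (ix i a))).
by apply: (can_inj absz_nat); rewrite -!dg_colE e.
Qed.

Lemma mon_neq (m m' : mon) : m != m' -> exists i a, m (ix i a) != m' (ix i a).
Proof.
move=> /eqP ne; apply: boolp.contrapT => no; apply: ne; apply/mnmP => v.
have [[i a] _ <-] : exists2 ia, true & uncurry ix ia = v.
  case: (curry_mxvec_bij d k) => g _ Kg; exists (g v) => //.
  by apply: Kg.
apply/eqP/negP => /negP ne; apply: no.
by exists i, a.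
Qed.

End Segre.

Notation R0 := (@Ordinal 3 0 isT).
Notation R1 := (@Ordinal 3 1 isT).
Notation R2 := (@Ordinal 3 2 isT).

(** * Circuits with three rows *)

Section ThreeRows.
Variable k : nat.
Notation mon := 'X_{1..(3 * k)}.
Notation dg := (mon_degree (@segre_deg 3 k)).
Notation ix := (@mxvec_index 3 k).
Notation x := (@xv 3 k).

Lemma three_rows (i j l t : 'I_3) : i != j -> j != l -> l != i ->
  [\/ t = i, t = j | t = l].
Proof.
rewrite -!(inj_eq val_inj) /= => ij jl li.
case: (eqVneq t i) => [->|]; first by constructor 1.
case: (eqVneq t j) => [->|]; first by constructor 2.
rewrite -!(inj_eq val_inj) /= => tj ti; constructor 3; apply: val_inj => /=.
have := ltn_ord i; have := ltn_ord j; have := ltn_ord l; have := ltn_ord t; lia.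
Qed.

(* The two monomials differ along an alternating cycle of the complete
   bipartite graph on rows and columns; with three rows it may be chosen of
   length 4 or 6. *)
Lemma circuit_exists (m m' : mon) : dg m = dg m' -> m != m' ->
  (exists i j a b, [/\ i != j,
     (m' (ix i a) < m (ix i a))%N, (m' (ix j b) < m (ix j b))%N,
     (m (ix i b) < m' (ix i b))%N & (m (ix j a) < m' (ix j a))%N]) \/
  (exists i j l a b c, [/\ [/\ i != j, j != l & l != i],
     [/\ (m' (ix i a) < m (ix i a))%N, (m' (ix j b) < m (ix j b))%N
       & (m' (ix l c) < m (ix l c))%N]
   & [/\ (m (ix j a) < m' (ix j a))%N, (m (ix l b) < m' (ix l b))%N
       & (m (ix i c) < m' (ix i c))%N]]).
Proof.
move=> e ne.
(* An arc leads from a row where [m] exceeds [m'] to a row where it falls short, within one column.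
   Equal row and column sums let every arc be continued, so a walk on three rows closes after two or
   three arcs. *)
pose arc i j := exists a,
  (m' (ix i a) < m (ix i a))%N /\ (m (ix j a) < m' (ix j a))%N.
have next i a : (m' (ix i a) < m (ix i a))%N -> exists j, arc i j.
  by move=> lt; have [j jlt] := col_exchange e lt; exists j, a.
have step i j : arc i j -> exists l, arc j l.
  by move=> [a [_ /(row_exchange (esym e))[b /next]]].
have arc_neq i j : arc i j -> i != j.
  by move=> [a [lt lt']]; apply/eqP => ij; subst j; move: lt lt'; lia.
have cycle2 i j : arc i j -> arc j i -> exists i j a b, [/\ i != j,
     (m' (ix i a) < m (ix i a))%N, (m' (ix j b) < m (ix j b))%N,
     (m (ix i b) < m' (ix i b))%N & (m (ix j a) < m' (ix j a))%N].
  by move=> ij [b [h1 h2]]; have [a [h3 h4]] := ij;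
    exists i, j, a, b; split=> //; apply: arc_neq.
have [i0 [a0 a0lt]] : exists i a, (m' (ix i a) < m (ix i a))%N.
  have [i [a]] := mon_neq ne; rewrite neq_ltn => /orP[lt|lt]; last by exists i, a.
  by have [b blt] := row_exchange (esym e) lt; exists i, b.
have [i1 a01] := next _ _ a0lt; have [i2 a12] := step _ _ a01.
have [i20|i20] := eqVneq i2 i0; first by left; subst i2; apply: cycle2 a01 a12.
have [i3 a23] := step _ _ a12.
case: (three_rows i3 (arc_neq _ _ a01) (arc_neq _ _ a12) i20) => e3; subst i3.
- right; have [a [h1 h2]] := a01; have [b [h3 h4]] := a12.
  have [c [h5 h6]] := a23; exists i0, i1, i2, a, b, c.
  by do !split=> //; apply: arc_neq.
- by left; apply: cycle2 a12 a23.
- by have := arc_neq _ _ a23; rewrite eqxx.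
Qed.

End ThreeRows.

(** * Standard quadrics and cubics determine the standard monomials *)

Section Standard.
Variable k : nat.
Notation mon := 'X_{1..(3 * k)}.
Notation dg := (mon_degree (@segre_deg 3 k)).
Notation ix := (@mxvec_index 3 k).
Notation x := (@xv 3 k).

Lemma xv_gt0 i a j b : (0 < x i a (ix j b))%N -> i = j /\ a = b.
Proof. by rewrite xvE lt0b => /andP[/eqP-> /eqP->]. Qed.

Lemma le_xv2 i j a b (m : mon) : i != j ->
  (0 < m (ix i a))%N -> (0 < m (ix j b))%N -> (x i a + x j b <= m)%MM.
Proof.
move=> ij mi mj; apply/mnm_lepP => v; rewrite mnmDE !mnm1E.
have [<-|_] := eqVneq (ix i a) v; last by case: eqP => [<-|].
by rewrite ix_inj eq_sym (negPf ij).
Qed.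

Lemma le_xv3 i j l a b c (m : mon) : i != j -> j != l -> l != i ->
  (0 < m (ix i a))%N -> (0 < m (ix j b))%N -> (0 < m (ix l c))%N ->
  (x i a + x j b + x l c <= m)%MM.
Proof.
move=> ij jl li mi mj ml; apply/mnm_lepP => v; rewrite !mnmDE !mnm1E.
have [<-|_] := eqVneq (ix i a) v.
  by rewrite !ix_inj eq_sym (negPf ij) (negPf li).
have [<-|_] := eqVneq (ix j b) v; last by case: eqP => [<-|].
by rewrite !ix_inj eq_sym (negPf jl).
Qed.

Lemma xv2_gt0 i j a b i0 a0 : (0 < (x i a + x j b)%MM (ix i0 a0))%N ->
  (i0 = i /\ a0 = a) \/ (i0 = j /\ a0 = b).
Proof.
by rewrite mnmDE addn_gt0 => /orP[/xv_gt0[-> ->]|/xv_gt0[-> ->]]; [left|right].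
Qed.

Lemma xv3_gt0 i j l a b c i0 a0 : (0 < (x i a + x j b + x l c)%MM (ix i0 a0))%N ->
  [\/ i0 = i /\ a0 = a, i0 = j /\ a0 = b | i0 = l /\ a0 = c].
Proof.
rewrite mnmDE addn_gt0 => /orP[/xv2_gt0[]|/xv_gt0[-> ->]]; last by constructor 3.
  by constructor 1.
by constructor 2.
Qed.

Variable S : mon -> bool.
Hypothesis mS : monomial_set (@segre_deg 3 k) S.

Lemma std_le m m' : (m <= m')%MM -> S m' -> S m.
Proof. by move=> /mnm_leD ->; apply: pcoh_divisor mS.1. Qed.

Lemma std_xv2 i j a b m : i != j -> S m ->
  (0 < m (ix i a))%N -> (0 < m (ix j b))%N -> S (x i a + x j b)%MM.
Proof. by move=> ij Sm mi mj; apply: std_le Sm; apply: le_xv2. Qed.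

Lemma std_xv3 i j l a b c m : i != j -> j != l -> l != i -> S m ->
  (0 < m (ix i a))%N -> (0 < m (ix j b))%N -> (0 < m (ix l c))%N ->
  S (x i a + x j b + x l c)%MM.
Proof. by move=> ij jl li Sm mi mj ml; apply: std_le Sm; apply: le_xv3. Qed.

Lemma std_asym i j a b : i != j ->
  S (x i a + x j b)%MM -> S (x i b + x j a)%MM -> a = b.
Proof.
move=> ij S1 S2; have e : (x i a + x j b = x i b + x j a)%MM.
  by apply: mS.2 => //; have := dg_swap i j a b 0%MM; rewrite !addm0.
have /mnmP/(_ (ix i a)) := e; rewrite !mnmDE !xvE !eqxx [j == i]eq_sym (negPf ij).
by case: eqP.
Qed.

(* Every nonstandard monomial contains one half of a circuit, the other half
   of which divides the standard monomial of the same degree. *)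
Lemma nonstd_circuit m : ~~ S m -> exists s, [/\ S s, dg s = dg m &
  (exists i j a b, [/\ i != j, a != b,
     (0 < m (ix i a))%N, (0 < m (ix j b))%N & S (x i b + x j a)%MM /\
     (0 < s (ix i b))%N /\ (0 < s (ix j a))%N]) \/
  (exists i j l a b c, [/\ [/\ i != j, j != l & l != i],
     [/\ a != b, b != c & a != c],
     [/\ (0 < m (ix i a))%N, (0 < m (ix j b))%N & (0 < m (ix l c))%N]
   & S (x j a + x l b + x i c)%MM])].
Proof.
have pos u v : (u < v -> 0 < v)%N by apply: leq_ltn_trans.
move=> nSm; have [s ds Ss] := mS.1.1 m; exists s; split=> //.
have ne : m != s by apply: contraNneq nSm => ->.
case: (circuit_exists (esym ds) ne) => [[i [j [a [b [ij h1 h2 h3 h4]]]]]|].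
  left; exists i, j, a, b; split; rewrite ?(pos _ _ h1) ?(pos _ _ h2) //.
    by apply/eqP => ab; subst b; move: h1 h3; lia.
  have h3' := pos _ _ h3; have h4' := pos _ _ h4.
  by split=> //; apply: std_xv2 ij Ss _ _.
move=> [i [j [l [a [b [c [[ij jl li] [h1 h2 h3] [h4 h5 h6]]]]]]]]; right.
exists i, j, l, a, b, c.
have ab : a != b by apply/eqP => e; subst b; move: h2 h4; lia.
have bc : b != c by apply/eqP => e; subst c; move: h3 h5; lia.
have ac : a != c by apply/eqP => e; subst c; move: h1 h6; lia.
split; rewrite ?(pos _ _ h1) ?(pos _ _ h2) ?(pos _ _ h3) //.
exact: std_xv3 jl li ij Ss (pos _ _ h4) (pos _ _ h5) (pos _ _ h6).
Qed.

(** A quadric has room only for half of a circuit of length 4, whose other half is the swapped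
    quadric. *)
Lemma std_total i j a b : i != j ->
  S (x i a + x j b)%MM || S (x i b + x j a)%MM.
Proof.
move=> ij; have [//|/nonstd_circuit[s [_ _ [|]]] /=] := boolP (S (x i a + x j b)%MM).
  move=> [i0 [j0 [a0 [b0 [ij0 _ /xv2_gt0 h1 /xv2_gt0 h2 [S0 _]]]]]].
  case: h1 => -[? ?]; case: h2 => -[? ?]; subst; try by rewrite eqxx in ij0.
    by [].
  by rewrite addmC.
move=> [i0 [j0 [l0 [a0 [b0 [c0 [[ij0 jl0 li0] _ [h1 h2 h3] _]]]]]]].
case: (xv2_gt0 h1) => -[? ?]; case: (xv2_gt0 h2) => -[? ?];
  case: (xv2_gt0 h3) => -[? ?]; subst; by rewrite ?eqxx in ij0 jl0 li0.
Qed.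

(** A cyclic relation on [a], [b], [c] would give each of x_ia x_jb x_jc, x_ib x_ja x_jc and x_ic
    x_ja x_jb a nonstandard quadratic divisor, leaving their common degree without a standard
    monomial. The circuits met in two of these locate enough variables of the standard monomial [s]
    to reach the contradiction. *)
Lemma std_trans i j a b c : i != j ->
  S (x i a + x j b)%MM -> S (x i b + x j c)%MM -> S (x i a + x j c)%MM.
Proof.
move=> ij Sab Sbc; apply: boolp.contrapT => /negP nac.
have Sca : S (x i c + x j a)%MM by have := std_total a c ij; rewrite (negPf nac).
have ne_ab : a != b by apply: contraNneq nac => ->.
have ne_bc : b != c by apply: contraNneq nac => <-.
have ne_ac : a != c by apply: contraNneq nac => ac; rewrite -{1}ac ac in Sca *.
have nba : ~~ S (x i b + x j a)%MM by apply: contraNN ne_ab => /(std_asym ij Sab)->.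
have ncb : ~~ S (x i c + x j b)%MM by apply: contraNN ne_bc => /(std_asym ij Sbc)->.
pose M a b c := (x i a + (x j b + x j c))%MM.
have MC a' b' c' : M a' b' c' = M a' c' b' by rewrite /M [(x j _ + _)%MM]addmC.
have ji : j != i by rewrite eq_sym.
have M_gt0 a' b' c' i0 a0 : (0 < M a' b' c' (ix i0 a0))%N ->
    [\/ i0 = i /\ a0 = a', i0 = j /\ a0 = b' | i0 = j /\ a0 = c'].
  by rewrite /M addmA => /xv3_gt0.
have nM a' b' c' : ~~ S (x i a' + x j b')%MM -> ~~ S (M a' b' c').
  by apply: contraNN; apply: std_le; rewrite /M addmA lem_addr.
have key a' b' c' : ~~ S (M a' b' c') -> exists s,
    [/\ S s, dg s = dg (M a' b' c') & (0 < s (ix j a'))%N /\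
      exists2 b0, b0 \in [:: b'; c'] & (0 < s (ix i b0))%N].
  move=> /nonstd_circuit[s [Ss ds cir]]; exists s; split=> //.
  case: cir => [|[i0 [j0 [l0 [a0 [b0 [c0 [[ij0 jl0 li0] _ [h1 h2 h3] _]]]]]]]].
    move=> [i0 [j0 [a0 [b0 [ij0 _ /M_gt0 h1 /M_gt0 h2 [_ [s1 s2]]]]]]].
    move: ij0 s1 s2; case: h1 => -[-> ->]; case: h2 => -[-> ->];
      try (by rewrite eqxx); move=> _ s1 s2; split=> //;
      solve [exists b' => //; rewrite inE eqxx // | exists c' => //; rewrite !inE eqxx orbT //].
  by case: (M_gt0 _ _ _ _ _ h1) => -[? ?]; case: (M_gt0 _ _ _ _ _ h2) => -[? ?];
    case: (M_gt0 _ _ _ _ _ h3) => -[? ?]; subst; rewrite ?eqxx in ij0 jl0 li0.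
have dM a' b' c' : dg (M a' b' c') = dg (M b' a' c').
  by rewrite /M !addmA dg_swap.
have [s [Ss ds [sja [b0 b0in sib]]]] := key a c b (nM _ _ _ nac).
have [s' [Ss' ds' [sjb _]]] := key b a c (nM _ _ _ nba).
have es : s' = s by apply: mS.2; rewrite // ds' ds dM [M a c b]MC.
subst s'.
move: b0in; rewrite !inE => /orP[/eqP e|/eqP e]; subst b0.
  by case/negP: ncb; apply: std_xv2 Ss sib sjb.
by case/negP: nba; apply: std_xv2 Ss sib sja.
Qed.

Lemma dg_cycle i j l a b c :
  dg (x i a + x j b + x l c)%MM = dg (x j a + x l b + x i c)%MM.
Proof.
rewrite !mon_degreeD !dg_xv; congr (_, _) => /=.
by rewrite [in RHS]addrC addrA.
Qed.

Lemma std_cycle i j l a b c : i != j -> j != l -> l != i -> a != c ->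
  S (x i a + x j b + x l c)%MM -> S (x j a + x l b + x i c)%MM -> False.
Proof.
move=> ij jl li ac S1 S2; have e := mS.2 _ _ (dg_cycle i j l a b c) S1 S2.
have /mnmP/(_ (ix i a)) := e; rewrite !mnmDE !xvE !eqxx.
by rewrite [j == i]eq_sym (negPf ij) (negPf li) [c == a]eq_sym (negPf ac).
Qed.

(** A numeric stand-in for the total order of the columns attached to rows [i] and [j], turning
    comparisons into linear arithmetic. *)
Definition rank (i j : 'I_3) (a : 'I_k) : nat := #|[pred c | S (x i c + x j a)%MM]|.

Lemma std_refl i j a : S (x i a + x j a)%MM.
Proof.
have [->|ij] := eqVneq i j; last by have := std_total a a ij; rewrite orbb.
have [s ds Ss] := mS.1.1 (x j a + x j a)%MM.
have [<- //|ne] := eqVneq s (x j a + x j a)%MM.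
case: (circuit_exists (esym ds) _); first by rewrite eq_sym.
  move=> [i0 [j0 [a0 [b0 [/eqP ij0 h1 h2 _ _]]]]]; case: ij0.
  by have [[-> _]|[-> _]] := xv2_gt0 (leq_ltn_trans (leq0n _) h1);
    have [[-> _]|[-> _]] := xv2_gt0 (leq_ltn_trans (leq0n _) h2).
move=> [i0 [j0 [l0 [a0 [b0 [c0 [[/eqP ij0 _ _] [h1 h2 _] _]]]]]]]; case: ij0.
by have [[-> _]|[-> _]] := xv2_gt0 (leq_ltn_trans (leq0n _) h1);
  have [[-> _]|[-> _]] := xv2_gt0 (leq_ltn_trans (leq0n _) h2).
Qed.

Lemma rank_le i j a b : i != j -> (rank i j a <= rank i j b)%N = S (x i a + x j b)%MM.
Proof.
move=> ij; apply/idP/idP => [|Sab]; last first.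
  apply: subset_leq_card; apply/subsetP => c; rewrite !inE => Sca.
  exact: std_trans ij Sca Sab.
apply: contraTT => nSab; rewrite -ltnNge; apply: proper_card.
have Sba : S (x i b + x j a)%MM by have := std_total a b ij; rewrite (negPf nSab).
apply/properP; split; last by exists a; rewrite !inE ?std_refl.
by apply/subsetP => c; rewrite !inE => Scb; exact: std_trans ij Scb Sba.
Qed.

Lemma rank_inj i j : i != j -> injective (rank i j).
Proof.
move=> ij a b e; apply: (std_asym ij); rewrite -rank_le // e //.
Qed.

Lemma rank_lt i j a b : i != j -> a != b ->
  (rank i j a < rank i j b)%N = S (x i a + x j b)%MM.
Proof.
by move=> ij ab; rewrite -rank_le // ltn_neqAle (inj_eq (rank_inj ij)) ab.
Qed.

Definition triple (a b c : 'I_k) : bool := S (x R0 a + x R1 b + x R2 c)%MM.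

Definition cols (i : 'I_3) (m : mon) (a : 'I_k) : Prop := (0 < m (ix i a))%N.

Notation compat := (compatible (rank R0 R1) (rank R0 R2) (rank R1 R2) triple).

Lemma ord3P (i : 'I_3) : [\/ i = R0, i = R1 | i = R2].
Proof. exact: three_rows. Qed.

Lemma std_compatible m : S m -> compat (cols R0 m) (cols R1 m) (cols R2 m).
Proof.
move=> Sm; split=> [a b Xa Yb|a b Xa Yb|a b Xa Yb|a b c _ _ _ Xa Yb Zc].
- by rewrite rank_le //; apply: std_xv2 Sm _ _.
- by rewrite rank_le //; apply: std_xv2 Sm _ _.
- by rewrite rank_le //; apply: std_xv2 Sm _ _.
- by apply: std_xv3 Sm _ _ _.
Qed.

(** A nonstandard monomial contains half of a circuit whose other half is standard; compatibility
    makes the first half standard too, although both have the same degree. *)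
Lemma compatible_std m : compat (cols R0 m) (cols R1 m) (cols R2 m) -> S m.
Proof.
move=> [c12 c13 c23 c123]; apply: boolp.contrapT => /negP/nonstd_circuit[s [_ _]].
have P01 a b : cols R0 m a -> cols R1 m b -> S (x R0 a + x R1 b)%MM.
  by move=> ma mb; rewrite -rank_le //; apply: c12.
have P02 a b : cols R0 m a -> cols R2 m b -> S (x R0 a + x R2 b)%MM.
  by move=> ma mb; rewrite -rank_le //; apply: c13.
have P12 a b : cols R1 m a -> cols R2 m b -> S (x R1 a + x R2 b)%MM.
  by move=> ma mb; rewrite -rank_le //; apply: c23.
have pair i j a b : i != j -> cols i m a -> cols j m b ->
    S (x i a + x j b)%MM.
  case: (ord3P i) => ->; case: (ord3P j) => -> //= _ ma mb.
  - exact: P01.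
  - exact: P02.
  - by rewrite addmC; exact: P01.
  - exact: P12.
  - by rewrite addmC; exact: P02.
  - by rewrite addmC; exact: P12.
have trip i j l a b c : i != j -> j != l -> l != i -> a != b -> b != c -> a != c ->
    cols i m a -> cols j m b -> cols l m c ->
    S (x i a + x j b + x l c)%MM.
  move=> ij jl li ab bc ac.
  have [ba cb ca] : [/\ b != a, c != b & c != a] by split; rewrite eq_sym.
  have mAC : right_commutative (@mnm_add (3 * k)) by exact: Monoid.mulmAC.
  case: (ord3P i) ij jl li => ->; case: (ord3P j) => -> //=; case: (ord3P l) => -> //=
    _ _ _ ma mb mc.
  - exact: c123.
  - by rewrite mAC; apply: c123.
  - by rewrite [(x R1 a + _)%MM]addmC; apply: c123.
  - by rewrite addmC addmA; apply: c123.
  - by rewrite -addmA addmC; apply: c123.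
  - by rewrite addmC [(x R2 a + _)%MM]addmC addmA; apply: c123.
case=> [[i [j [a [b [ij ab ma mb [Sba _]]]]]]|].
  by case/eqP: ab; apply: (std_asym ij) Sba; apply: pair.
move=> [i [j [l [a [b [c [[ij jl li] [ab bc ac] [ma mb mc] S']]]]]]].
exact: (std_cycle ij jl li ac (trip _ _ _ _ _ _ ij jl li ab bc ac ma mb mc) S').
Qed.

End Standard.

Lemma compatible_sub (T : eqType) (p q r : T -> nat) tr
  (G1 G2 G3 H1 H2 H3 : T -> Prop) :
  compatible p q r tr G1 G2 G3 -> (forall a, H1 a -> G1 a) ->
  (forall a, H2 a -> G2 a) -> (forall a, H3 a -> G3 a) ->
  compatible p q r tr H1 H2 H3.
Proof.
move=> [c12 c13 c23 c123] s1 s2 s3.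
by split=> *; [apply: c12|apply: c13|apply: c23|apply: c123]; auto.
Qed.

(** * Flips that sort the order 23 *)

Section Improve.
Variable k : nat.
Notation mon := 'X_{1..(3 * k)}.
Notation deg := (@segre_deg 3 k).
Notation dg := (mon_degree deg).
Notation ix := (@mxvec_index 3 k).
Notation x := (@xv 3 k).

Lemma ix_surj v : exists i a, v = ix i a.
Proof.
case: (curry_mxvec_bij 3 k) => g _ gK; exists (g v).1, (g v).2.
by rewrite -[LHS]gK //; case: (g v).
Qed.

Section Facts.
Variable S : mon -> bool.
Hypothesis mS : monomial_set deg S.

Lemma triple_lt a b c : a != b -> b != c -> a != c -> triple S a b c ->
  [/\ (rank S R0 R1 a < rank S R0 R1 b)%N, (rank S R0 R2 a < rank S R0 R2 c)%N
    & (rank S R1 R2 b < rank S R1 R2 c)%N].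
Proof.
move=> ab bc ac t; rewrite !rank_lt //.
by split; apply: (std_xv2 mS _ t) => //; rewrite !mnmDE !xvE !eqxx /=; lia.
Qed.

Lemma triple_cycle a b c : a != b -> b != c -> a != c ->
  triple S a b c -> triple S b c a -> False.
Proof.
move=> ab bc ac t t'; apply: (std_cycle mS (i := R0) (j := R2) (l := R1) (a := a)
  (b := c) (c := b)) => //.
  by move: t; rewrite /triple -addmA [(x R1 b + _)%MM]addmC addmA.
by move: t'; rewrite /triple addmC [(x R0 b + _)%MM]addmC addmA.
Qed.

(** All pairs being standard, only a circuit of length 6 can make the cubic nonstandard, and its
    standard half is a cyclic rotation of the columns. *)
Lemma triple_exists a b c : a != b -> b != c -> a != c ->
  (rank S R0 R1 a < rank S R0 R1 b)%N -> (rank S R0 R2 a < rank S R0 R2 c)%N ->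
  (rank S R1 R2 b < rank S R1 R2 c)%N ->
  [|| triple S a b c, triple S b c a | triple S c a b].
Proof.
move=> ab bc ac pab qac rbc; apply: boolp.contrapT => /negP.
rewrite !negb_or => /and3P[n1 n2 n3].
pose f (i : 'I_3) := nth a [:: a; b; c] i.
have sup i a0 : (0 < (x R0 a + x R1 b + x R2 c)%MM (ix i a0))%N -> a0 = f i.
  by case/xv3_gt0 => -[-> ->].
have [s [_ _ [|]]] := nonstd_circuit mS n1.
  move=> [i [j [a0 [b0 [ij ab0 /sup ea /sup eb [S' _]]]]]]; subst a0 b0.
  case/eqP: ab0; apply: (std_asym mS ij) S'.
  move: pab qac rbc; rewrite !rank_lt // => pab qac rbc.
  move: ij; case: (ord3P i) => ->; case: (ord3P j) => -> //= _.
  - by rewrite addmC.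
  - by rewrite addmC.
  - by rewrite addmC.
move=> [i [j [l [a0 [b0 [c0 [[ij jl li] _ [/sup ea /sup eb /sup ec] S']]]]]]].
have mAC : right_commutative (@mnm_add (3 * k)) by exact: Monoid.mulmAC.
move: S'; rewrite ea eb ec {ea eb ec}; apply/negP.
move: ij jl li; case: (ord3P i) => ->; case: (ord3P j) => -> //; case: (ord3P l) => -> //.
all: move=> _ _ _; rewrite /f /= /triple in n2 n3 *.
- by rewrite addmC addmA.
- by rewrite addmC [(x R2 a + _)%MM]addmC addmA.
- by rewrite mAC.
- by rewrite -addmA addmC.
- by rewrite [(x R1 c + _)%MM]addmC.
Qed.

End Facts.

Definition inversions (S : mon -> bool) : nat :=
  #|[pred ab : 'I_k * 'I_k | (rank S R0 R2 ab.1 < rank S R0 R2 ab.2)%N &&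
                             (rank S R1 R2 ab.2 < rank S R1 R2 ab.1)%N]|.

(** Entries (l, j, h) for the cubics obstructing the reversal of an inverted pair h, j; the
    secondary measure of the sorting. *)
Definition bad_triples (S : mon -> bool) : nat :=
  #|[pred t : 'I_k * 'I_k * 'I_k |
      [&& t.1.1 != t.1.2, t.1.1 != t.2, triple S t.1.1 t.1.2 t.2,
          (rank S R0 R1 t.2 < rank S R0 R1 t.1.1)%N,
          (rank S R0 R2 t.2 < rank S R0 R2 t.1.2)%N
        & (rank S R1 R2 t.1.2 < rank S R1 R2 t.2)%N]]|.

Section Transfer.
Variables S S' : mon -> bool.
Hypotheses (mS : monomial_set deg S) (mS' : monomial_set deg S').
Variable al : mon.
Hypothesis agree : forall m, S m -> ~~ (al <= m)%MM -> S' m.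

(** Otherwise the opposite quadric is standard for [S]; not being divisible by [al], it survives the
    flip, against antisymmetry for [S']. *)
Lemma rank_lt_transfer i j a b : i != j -> ~~ (al <= x i b + x j a)%MM ->
  (rank S' i j a < rank S' i j b)%N -> (rank S i j a < rank S i j b)%N.
Proof.
move=> ij nal lt; have ab : a != b by apply: contraTneq lt => ->; rewrite ltnn.
move: lt; rewrite !rank_lt // => S'ab.
have [//|nS] := boolP (S (x i a + x j b)%MM).
have Sba : S (x i b + x j a)%MM by have := std_total mS a b ij; rewrite (negPf nS).
by case/eqP: ab; apply: (std_asym mS' ij S'ab); apply: agree.
Qed.

End Transfer.

Section SortingStep.
Variable S : mon -> bool.
Hypothesis mS : monomial_set deg S.
Notation p := (rank S R0 R1).
Notation q := (rank S R0 R2).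
Notation r := (rank S R1 R2).

Variables j h : 'I_k.
Hypotheses (qhj : (q h < q j)%N) (rjh : (r j < r h)%N).
Hypothesis sorted_below : forall l y,
  ((q l < q h)%N ==> (q l < q y)%N ==> (r l < r y)%N).
Hypothesis adjacent : forall y, ~~ (r j < r y < r h)%N.

Let p_inj : injective p. Proof. exact: rank_inj. Qed.
Let q_inj : injective q. Proof. exact: rank_inj. Qed.
Let r_inj : injective r. Proof. exact: rank_inj. Qed.

Let hj : h != j.
Proof. by apply: contraTneq qhj => ->; rewrite ltnn. Qed.

Let jh : j != h. Proof. by rewrite eq_sym hj. Qed.

Lemma quadric_step :
  (forall l, l != j -> l != h -> triple S l j h -> (p l < p h)%N) ->
  exists S', [/\ monomial_set deg S', (inversions S' < inversions S)%N
    & forall Q : (mon -> bool) -> Prop,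
      (forall P w, pcoh deg P -> Q P <-> Q (initial deg w P)) -> Q S -> Q S'].
Proof.
move=> nc.
pose al := (x R1 j + x R2 h)%MM; pose be := (x R1 h + x R2 j)%MM.
have dab : dg al = dg be by have := dg_swap R1 R2 j h 0%MM; rewrite !addm0.
have alE i a : al (ix i a) = ((R1 == i) && (j == a) + ((R2 == i) && (h == a)))%N.
  by rewrite mnmDE !xvE.
have beE i a : be (ix i a) = ((R1 == i) && (h == a) + ((R2 == i) && (j == a)))%N.
  by rewrite mnmDE !xvE.
have Sal : S al.
  by move: rjh; rewrite rank_lt.
have [S' [mS' S'be agree inv]] : exists S',
  [/\ monomial_set deg S', S' be, forall m, S m -> ~~ (al <= m)%MM -> S' m
    & forall Q : (mon -> bool) -> Prop,
      (forall P w, pcoh deg P -> Q P <-> Q (initial deg w P)) -> Q S -> Q S'].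
  apply: (@flip_exists _ _ deg S al be (ix R1 j) (ix R1 h)) => //.
  - by rewrite alE !eqxx.
  - by rewrite beE !eqxx.
  - move=> v; have [i [a ->]] := ix_surj v; rewrite alE beE.
    case: (ord3P i) => ->; rewrite /= ?addn0; first by left.
      by case: (eqVneq j a) => [<-|]; [right; rewrite (negPf hj)|left].
    by case: (eqVneq h a) => [<-|]; [right; rewrite (negPf jh)|left].
  - move=> g v; have [i [a ->]] := ix_surj v => bev g0 /(std_compatible mS) GG.
    have {}GG : compatible p q r (triple S) (cols R0 g) (adjoin j (cols R1 g)) (adjoin h (cols R2 g)).
      by apply: (compatible_sub GG) => b; rewrite /cols mnmDE alE /=;
        [|case=> [->|]; rewrite ?eqxx|case=> [->|]; rewrite ?eqxx]; lia.
    apply: compatible_std => //.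
    have entry i0 b : (g + be - U_(ix i a))%MM (ix i0 b) = (g (ix i0 b) +
        ((R1 == i0) && (h == b) + ((R2 == i0) && (j == b))) - ((i == i0) && (a == b)))%N.
      by rewrite mnmBE mnmDE beE mnm1E ix_inj.
    have [[ei ea]|[ei ea]] : (i = R1 /\ a = h) \/ (i = R2 /\ a = j).
      by apply: xv2_gt0; rewrite lt0n.
    + subst i a; have ng : ~ cols R1 g h by rewrite /cols g0.
      have F := quadric_flip_j p_inj q_inj r_inj (triple_lt mS) (triple_exists mS)
        qhj rjh sorted_below adjacent nc GG ng.
      apply: (compatible_sub F) => b; rewrite /cols entry /=; [lia|lia|].
      by case: (eqVneq j b) => [<-|_]; [left | right; lia].
    subst i a; have ng : ~ cols R2 g j by rewrite /cols g0.
    have F := quadric_flip_k p_inj q_inj r_inj (triple_lt mS) (triple_exists mS)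
      qhj rjh sorted_below adjacent nc GG ng.
    apply: (compatible_sub F) => b; rewrite /cols entry /=; [lia| |lia].
    by case: (eqVneq h b) => [<-|_]; [left | right; lia].
exists S'; split=> //; apply: proper_card; apply/properP; split.
  apply/subsetP => -[a b]; rewrite !inE /= => /andP[qab rba].
  have nal c1 c2 : ~~ (al <= x R0 c1 + x R2 c2)%MM.
    apply/negP => /mnm_lepP/(_ (ix R1 j)); rewrite alE mnmDE !xvE.
    by rewrite !eqxx.
  have {}qab := rank_lt_transfer mS mS' agree (i := R0) (j := R2) isT (nal _ _) qab.
  rewrite qab /=; apply: (rank_lt_transfer mS mS' agree _ _ rba) => //.
  (* Divisibility by [al] would make [(a, b)] equal to [(j, h)], which contradicts [q a < q b]. *)
  apply/negP => /mnm_lepP le.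
  have := le (ix R1 j); rewrite alE mnmDE !xvE !eqxx /=; case: eqP => // eaj _.
  have := le (ix R2 h); rewrite alE mnmDE !xvE !eqxx /=; case: eqP => // ebh _.
  by move: qab; rewrite eaj ebh ltnNge (ltnW qhj).
exists (h, j); rewrite !inE /= ?qhj ?rjh //.
rewrite [X in _ && X]rank_lt // negb_and; apply/orP; right; apply/negP => S'al.
by case/eqP: jh; apply: (std_asym mS' (i := R1) (j := R2)) S'al S'be.
Qed.

(** As [al] has degree 3, no quadric is touched and the orders persist; the progress is that [al]
    itself stops being standard. *)
Lemma cubic_step l : l != j -> l != h -> triple S l j h -> (p h < p l)%N ->
  (forall y, y != j -> y != h -> triple S y j h -> (p y <= p l)%N) ->
  exists S', [/\ monomial_set deg S', (inversions S' <= inversions S)%N,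
    (bad_triples S' < bad_triples S)%N
    & forall Q : (mon -> bool) -> Prop,
      (forall P w, pcoh deg P -> Q P <-> Q (initial deg w P)) -> Q S -> Q S'].
Proof.
move=> lj lh trl phl lmax.
have [plj qlh _] := triple_lt mS lj jh lh trl.
pose al := (x R0 l + x R1 j + x R2 h)%MM.
pose be := (x R0 h + x R1 l + x R2 j)%MM.
have dab : dg al = dg be.
  by rewrite /al dg_cycle [be]addmC [(x R0 h + _)%MM]addmC addmA [(x R2 j + _)%MM]addmC.
have alE i a : al (ix i a) = ((R0 == i) && (l == a) + ((R1 == i) && (j == a))
    + ((R2 == i) && (h == a)))%N.
  by rewrite !mnmDE !xvE.
have beE i a : be (ix i a) = ((R0 == i) && (h == a) + ((R1 == i) && (l == a))
    + ((R2 == i) && (j == a)))%N.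
  by rewrite !mnmDE !xvE.
have [S' [mS' S'be agree inv]] : exists S',
  [/\ monomial_set deg S', S' be, forall m, S m -> ~~ (al <= m)%MM -> S' m
    & forall Q : (mon -> bool) -> Prop,
      (forall P w, pcoh deg P -> Q P <-> Q (initial deg w P)) -> Q S -> Q S'].
  apply: (@flip_exists _ _ deg S al be (ix R0 l) (ix R0 h)) => //.
  - by rewrite alE !eqxx.
  - by rewrite beE !eqxx.
  - move=> v; have [i [a ->]] := ix_surj v; rewrite alE beE.
    case: (ord3P i) => ->; rewrite /= ?addn0.
    + by case: (eqVneq l a) => [<-|]; [right; rewrite eq_sym (negPf lh)|left].
    + by case: (eqVneq j a) => [<-|]; [right; rewrite (negPf lj)|left].
    + by case: (eqVneq h a) => [<-|]; [right; rewrite (negPf jh)|left].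
  - move=> g v; have [i [a ->]] := ix_surj v => bev g0 /(std_compatible mS) GG.
    have {}GG : compatible p q r (triple S) (adjoin l (cols R0 g))
        (adjoin j (cols R1 g)) (adjoin h (cols R2 g)).
      by apply: (compatible_sub GG) => b; rewrite /cols mnmDE alE /=;
        case=> [->|]; rewrite ?eqxx; lia.
    apply: compatible_std => //.
    have entry i0 b : (g + be - U_(ix i a))%MM (ix i0 b) = (g (ix i0 b) +
        ((R0 == i0) && (h == b) + ((R1 == i0) && (l == b)) + ((R2 == i0) && (j == b)))
        - ((i == i0) && (a == b)))%N.
      by rewrite mnmBE mnmDE beE mnm1E ix_inj.
    have trL := triple_lt mS; have trE := triple_exists mS.
    have [[ei ea]|[ei ea]|[ei ea]] : [\/ i = R0 /\ a = h, i = R1 /\ a = l | i = R2 /\ a = j].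
      by apply: xv3_gt0; rewrite lt0n.
    + subst i a; have ng : ~ cols R0 g h by rewrite /cols g0.
      have F := cubic_flip_k p_inj q_inj r_inj trL trE
        qhj rjh sorted_below adjacent lj lh trl phl lmax GG ng.
      apply: (compatible_sub F) => b; rewrite /cols entry /=; first by lia.
        by case: (eqVneq l b) => [<-|_]; [left | right; lia].
      by case: (eqVneq j b) => [<-|_]; [left | right; lia].
    + subst i a; have ng : ~ cols R1 g l by rewrite /cols g0.
      have F := cubic_flip_l p_inj q_inj r_inj trL trE
        qhj rjh sorted_below adjacent lj lh trl phl lmax GG ng.
      apply: (compatible_sub F) => b; rewrite /cols entry /=; last 2 first.
      * by lia.
      * by case: (eqVneq j b) => [<-|_]; [left | right; lia].
      by case: (eqVneq h b) => [<-|_]; [left | right; lia].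
    subst i a; have ng : ~ cols R2 g j by rewrite /cols g0.
    have F := cubic_flip_j p_inj q_inj r_inj trL trE
      qhj rjh sorted_below adjacent lj lh trl phl lmax GG ng.
    apply: (compatible_sub F) => b; rewrite /cols entry /=; last by lia.
      by case: (eqVneq h b) => [<-|_]; [left | right; lia].
    by case: (eqVneq l b) => [<-|_]; [left | right; lia].
have nal2 i i' a b : ~~ (al <= x i a + x i' b)%MM.
  apply/negP => /mnm_lepP le.
  have : (mdeg al <= mdeg (x i a + x i' b)%MM)%N.
    by rewrite !mdegE; apply: leq_sum => v _; apply: le.
  by rewrite !mdegD !mdeg1.
have transfer i i' a b : i != i' ->
    (rank S' i i' a < rank S' i i' b)%N -> (rank S i i' a < rank S i i' b)%N.
  by move=> ii; apply: (rank_lt_transfer mS mS' agree ii).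
exists S'; split=> //.
  apply: subset_leq_card; apply/subsetP => -[a b]; rewrite !inE /= => /andP[qab rba].
  by rewrite !transfer.
have nS'al : ~~ S' al.
  apply/negP => S'al; have := mS'.2 _ _ dab S'al S'be.
  by move/mnmP/(_ (ix R0 l)); rewrite alE beE !eqxx /= [h == l]eq_sym (negPf lh).
apply: proper_card; apply/properP; split.
  apply/subsetP => -[[a b] c]; rewrite !inE /= => /and5P[ab ac tabc pca /andP[qcb rbc]].
  rewrite ab ac !transfer // ?andbT.
  have bc : b != c by apply: contraTneq rbc => ->; rewrite ltnn.
  have [t1 t2 t3] := triple_lt mS' ab bc ac tabc.
  have Sagree a' b' c' : triple S a' b' c' -> ~~ triple S' a' b' c' ->
      [/\ a' = l, b' = j & c' = h].
    move=> t nt; have le : (al <= x R0 a' + x R1 b' + x R2 c')%MM.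
      by apply: contraR nt => nle; apply: agree.
    have le1 := mnm_lepP le (ix R0 l); have le2 := mnm_lepP le (ix R1 j).
    have le3 := mnm_lepP le (ix R2 h).
    move: le1 le2 le3; rewrite !alE !mnmDE !xvE !eqxx /=.
    by do 3!case: eqP => // ->.
  (* If the cubic was not standard for [S], one of its rotations was, and that rotation is lost in
     [S']; so it is [al], and the relations of a bad triple contradict those among [l], [j], [h]. *)
  case/or3P: (triple_exists mS ab bc ac (@transfer R0 R1 _ _ isT t1)
    (@transfer R0 R2 _ _ isT t2) (@transfer R1 R2 _ _ isT t3)) => [->//|t|t].
    have [t'|/(Sagree _ _ _ t)[eb ec ea]] := boolP (triple S' b c a).
      by case: (triple_cycle mS' ab bc ac tabc t').
    move: (@transfer R0 R2 _ _ isT qcb); rewrite eb ec ltnNge => /negP[].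
    exact: ltnW (ltn_trans qlh qhj).
  have [t'|/(Sagree _ _ _ t)[ec ea eb]] := boolP (triple S' c a b).
    by case: (@triple_cycle S' mS' c a b); rewrite // eq_sym.
  have := @transfer R1 R2 _ _ isT rbc; rewrite eb ec ltnNge => /negP[].
  have := sorted_below l j; rewrite qlh (ltn_trans qlh qhj) /= => rlj.
  exact: ltnW (ltn_trans rlj rjh).
exists (l, j, h); rewrite !inE /= lj lh; first by rewrite trl phl qhj rjh.
by rewrite [triple S' _ _ _](negPf nS'al).
Qed.

End SortingStep.
End Improve.

(** * Refinement to monomial sets and termination of the sorting *)

Section Monomialize.
Variables (G : zmodType) (n : nat) (deg : 'I_n -> G).
Notation mon := 'X_{1..n}.
Notation dg := (mon_degree deg).
Variable Q : (mon -> bool) -> Prop.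
Hypothesis invQ : forall P w, pcoh deg P -> Q P <-> Q (initial deg w P).

Lemma monomial_refinement P : pcoh deg P ->
  exists S, [/\ monomial_set deg S, forall m, S m -> P m & Q S -> Q P].
Proof.
move=> cP.
have [S [cS SP QSP Sv]] : exists S, [/\ pcoh deg S, forall m, S m -> P m, Q S -> Q P
  & forall m m', dg m = dg m' -> S m -> S m' ->
    forall v, v \in enum 'I_n -> m v = m' v].
  elim: (enum 'I_n) => [|v s [S [cS SP QSP Sv]]]; first by exists P.
  exists (initial deg (delta_wt v) S); split.
  - exact: pcoh_initial.
  - by move=> m /initialP[/SP].
  - by move=> QS; apply/QSP/(invQ (delta_wt v) cS).
  - move=> m m' e /initialP[Sm mm] /initialP[Sm' mm'] i.
    rewrite inE => /orP[/eqP->|]; last exact: Sv.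
    have := mm _ (esym e) Sm'; have := mm' _ e Sm; rewrite !wt_delta => le1 le2.
    by apply/eqP; rewrite eqn_leq le1 le2.
exists S; split=> //; split=> // m m' e Sm Sm'.
by apply/mnmP => v; apply: Sv => //; rewrite mem_enum.
Qed.

End Monomialize.

Section Sort.
Variable k : nat.
Notation mon := 'X_{1..(3 * k)}.
Notation deg := (@segre_deg 3 k).
Notation dg := (mon_degree deg).
Notation ix := (@mxvec_index 3 k).
Notation x := (@xv 3 k).
Variable Q : (mon -> bool) -> Prop.
Hypothesis invQ : forall P w, pcoh deg P -> Q P <-> Q (initial deg w P).

Lemma sorting_step S : monomial_set deg S -> (0 < inversions S)%N ->
  exists S', [/\ monomial_set deg S', Q S -> Q S' &
    (inversions S' < inversions S)%N \/
    (inversions S' <= inversions S)%N /\ (bad_triples S' < bad_triples S)%N].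
Proof.
move=> mS /card_gt0P[[a0 b0]]; rewrite inE /= => /andP[qab rba].
set q := rank S R0 R2 in qab *; set r := rank S R1 R2 in rba *.
have [h /existsP[j1 /andP[q1 r1]] hmin] :=
  @arg_minnP _ a0 (fun a => [exists b, (q a < q b)%N && (r b < r a)%N]) q
    (introT existsP (ex_intro _ b0 (introT andP (conj qab rba)))).
have [j /andP[qhj rjh] jmax] :=
  @arg_maxnP _ j1 (fun b => (q h < q b)%N && (r b < r h)%N) r
    (introT andP (conj q1 r1)).
have r_inj : injective r by apply: rank_inj.
have q_inj : injective q by apply: rank_inj.
have sorted l y : ((q l < q h)%N ==> (q l < q y)%N ==> (r l < r y)%N).
  apply/implyP => qlh; apply/implyP => qly; rewrite ltnNge; apply/negP => ryl.
  have : (q h <= q l)%N.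
    apply: hmin; apply/existsP; exists y; rewrite qly ltn_neqAle ryl andbT.
    by rewrite (inj_eq r_inj); apply: contraTneq qly => ->; rewrite ltnn.
  by rewrite leqNgt qlh.
(* By maximality of [j], a column strictly between would lie below [h] in the order 13, hence below
   [j] in the order 23 by sortedness. *)
have adj y : ~~ (r j < r y < r h)%N.
  apply/negP => /andP[ry yh].
  have := jmax y; rewrite yh andbT => jm.
  have qyh : (q y < q h)%N.
    rewrite ltn_neqAle (inj_eq q_inj) leqNgt; apply/andP; split.
      by apply: contraTneq yh => ->; rewrite ltnn.
    by apply/negP => /jm /leq_trans/(_ (leqnn _)); rewrite leqNgt ry.
  have := sorted y j; rewrite qyh (ltn_trans qyh qhj) /= => lt.
  by have := ltn_trans ry lt; rewrite ltnn.
pose T l := [&& l != j, l != h, triple S l j h & (rank S R0 R1 h < rank S R0 R1 l)%N].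
have [[l0 Tl0]|noT] := boolp.pselect (exists l, T l); last first.
  have [|S' [mS' lt inv]] := quadric_step mS qhj rjh sorted adj.
    move=> l lj lh t; rewrite ltn_neqAle (inj_eq (rank_inj mS _)) // lh /= leqNgt.
    by apply/negP => lt; apply: noT; exists l; rewrite /T lj lh t.
  by exists S'; split=> //; [apply: inv | left].
have [l /and4P[lj lh tl pl] lmax] := @arg_maxnP _ l0 T (rank S R0 R1) Tl0.
have [|S' [mS' le lt inv]] := cubic_step mS qhj rjh sorted adj lj lh tl pl.
  move=> y yj yh ty; case: (leqP (rank S R0 R1 y) (rank S R0 R1 h)) => [yle|ylt].
    exact: leq_trans yle (ltnW pl).
  by apply: lmax; rewrite /T yj yh ty.
by exists S'; split=> //; [apply: inv | right].
Qed.

Lemma rank_bound (S : mon -> bool) i i' a : (rank S i i' a <= k)%N.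
Proof. by rewrite -[leqRHS]card_ord max_card. Qed.

Definition row_wt (i : 'I_3) (f : 'I_k -> nat) (v : 'I_(3 * k)) : nat :=
  \sum_a f a * (ix i a == v).

Lemma wt_row_wt i f m : wt (row_wt i f) m = (\sum_a f a * m (ix i a))%N.
Proof.
rewrite /wt /row_wt; under eq_bigr => v _ do rewrite big_distrl.
rewrite exchange_big; apply: eq_bigr => a _ /=.
rewrite (bigD1 (ix i a)) //= eqxx muln1 big1 ?addn0 // => v vN.
by rewrite eq_sym (negPf vN) muln0 mul0n.
Qed.

Lemma wt_row_xv i f j b : wt (row_wt i f) (x j b) = ((i == j) * f b)%N.
Proof.
rewrite wt_row_wt (bigD1 b) //= xvE eqxx andbT [j == i]eq_sym mulnC.
by rewrite big1 ?addn0 // => a ab; rewrite xvE [b == a]eq_sym (negPf ab) andbF muln0.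
Qed.

(* The weights w3 and w2 recover the orders 13 (hence 23) and 12 of S. *)
Lemma sorted_end S : monomial_set deg S -> inversions S = 0%N -> Q S -> Q xpredT.
Proof.
move=> mS inv0 QS.
pose p := rank S R0 R1; pose q := rank S R0 R2; pose r := rank S R1 R2.
have noinv a b : ~~ ((q a < q b)%N && (r b < r a)%N).
  by have := card0_eq inv0 (a, b); rewrite inE /= => ->.
have cT : pcoh deg xpredT by split=> // m; exists m.
(* Ranks are at most [k], so the subtraction is exact; the lighter of x_1a x_3b and x_1b x_3a has
   the column of larger rank in row 3. *)
pose w3 := row_wt R2 (fun a => k - q a)%N; pose P1 := initial deg w3 xpredT.
pose w2 := row_wt R1 (fun a => k - p a)%N; pose P2 := initial deg w2 P1.
have cP1 : pcoh deg P1 by apply: pcoh_initial.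
have cP2 : pcoh deg P2 by apply: pcoh_initial.
have [S' [mS' S'P QS']] := monomial_refinement invQ cP2.
suff SE : S' = S.
  by apply/(invQ w3 cT)/(invQ w2 cP1)/QS'; rewrite SE.
have sw i j a b : dg (x i b + x j a)%MM = dg (x i a + x j b)%MM.
  by have := dg_swap i j b a 0%MM; rewrite !addm0.
have sub m : S' m -> S m.
  move=> S'm; apply: compatible_std => //.
  have c12 a b : cols R0 m a -> cols R1 m b -> (p a <= p b)%N.
    move=> ma mb; have /S'P/initialP[P1m mmin] : S' (x R0 a + x R1 b)%MM.
      exact: (std_xv2 mS' (i := R0) (j := R1) isT S'm ma mb).
    have := mmin _ (sw R0 R1 a b); rewrite !wtD !wt_row_xv /= !mul0n !mul1n !add0n.
    have qp := rank_bound S R0 R1 a; have qp' := rank_bound S R0 R1 b.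
    have -> : P1 (x R0 b + x R1 a)%MM.
      by apply/initialP; split=> // m' _ _; rewrite !wtD !wt_row_xv.
    by move=> /(_ isT); rewrite -/p in qp qp'; lia.
  have c13 a b : cols R0 m a -> cols R2 m b -> (q a <= q b)%N.
    move=> ma mb; have /S'P/initialP[/initialP[_ mmin] _] : S' (x R0 a + x R2 b)%MM.
      exact: (std_xv2 mS' (i := R0) (j := R2) isT S'm ma mb).
    have := mmin _ (sw R0 R2 a b) isT; rewrite !wtD !wt_row_xv /= !mul0n !mul1n !add0n.
    have qp := rank_bound S R0 R2 a; have qp' := rank_bound S R0 R2 b.
    by rewrite -/q in qp qp'; lia.
  have c23 a b : cols R1 m a -> cols R2 m b -> (r a <= r b)%N.
    move=> ma mb; have /S'P/initialP[/initialP[_ mmin] _] : S' (x R1 a + x R2 b)%MM.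
      exact: (std_xv2 mS' (i := R1) (j := R2) isT S'm ma mb).
    have := mmin _ (sw R1 R2 a b) isT; rewrite !wtD !wt_row_xv /= !mul0n !mul1n !add0n.
    have qp := rank_bound S R0 R2 a; have qp' := rank_bound S R0 R2 b.
    rewrite -/q in qp qp' => le; have qab : (q a <= q b)%N by lia.
    have [->//|ab] := eqVneq a b; rewrite leqNgt; apply/negP => rba.
    case/negP: (noinv a b); rewrite rba andbT ltn_neqAle qab andbT.
    by rewrite (inj_eq (rank_inj mS _)).
  split=> // a b c ab bc ac ma mb mc.
  have lt12 : (p a < p b)%N by rewrite ltn_neqAle c12 // andbT (inj_eq (rank_inj mS _)).
  have lt13 : (q a < q c)%N by rewrite ltn_neqAle c13 // andbT (inj_eq (rank_inj mS _)).
  have lt23 : (r b < r c)%N by rewrite ltn_neqAle c23 // andbT (inj_eq (rank_inj mS _)).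
  have [ba cb ca] : [/\ b != a, c != b & c != a] by split; rewrite eq_sym.
  case/or3P: (triple_exists mS ab bc ac lt12 lt13 lt23) => // t.
    have [_ _ rca] := triple_lt mS bc ca ba t.
    by case/negP: (noinv a c); rewrite lt13.
  have [_ qcb _] := triple_lt mS ca ab cb t.
  by case/negP: (noinv c b); rewrite qcb.
apply: boolp.funext => m; apply/idP/idP => [/sub//|Sm].
have [s ds S's] := mS'.1.1 m.
by rewrite -(mS.2 _ _ ds (sub _ S's) Sm).
Qed.

Lemma sort_to_generic S : monomial_set deg S -> Q S -> Q xpredT.
Proof.
(* [K] bounds the number of bad triples, so the measure below compares lexicographically. *)
pose K := #|{: 'I_k * 'I_k * 'I_k}|.
have [N] := ubnP (inversions S * K.+1 + bad_triples S)%N.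
elim: N S => // N IHN S ltN mS QS.
have [inv0|] := posnP (inversions S); first exact: sorted_end inv0 QS.
move=> /(sorting_step mS)[S' [mS' QS' dec]]; apply: IHN (mS') (QS' QS).
have bd (S0 : mon -> bool) : (bad_triples S0 < K.+1)%N by rewrite ltnS max_card.
move: ltN; rewrite ltnS => le; apply: (leq_trans _ le).
case: dec => [lt|[le' lt]]; last by rewrite -addnS leq_add // leq_mul2r le' orbT.
have : (inversions S' * K.+1 + K.+1 <= inversions S * K.+1)%N.
  by rewrite -mulSnr leq_mul2r lt orbT.
by have := bd S'; lia.
Qed.

End Sort.

(** * The determinantal ideal and its Hilbert function *)

Lemma cohI_rank_unique (G : zmodType) (n : nat) (deg : 'I_n -> G)
  (A : comNzRingType) (c : 'X_{1..n} -> A) b r :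
  coh deg c -> free_localization deg (cohI deg c) b 1 r ->
  r = semigroup_indicator deg b.
Proof.
move=> cc [e [eh span indep]].
have one_neq0 N : (1 : A) ^+ N * 1 <> 0.
  by rewrite expr1n mulr1; apply/eqP/oner_neq0.
have indep1 s : ev deg c b (e s) = 0 -> False.
  move=> es0; have [|N /(_ s)] := indep (fun t => (t == s)%:R).
    rewrite (bigD1 s) //= big1 ?addr0 => [|t /negPf->]; last by rewrite scale0r.
    rewrite eqxx scale1r => b'; have [<-//|nb] := eqVneq b b'.
    exact: ev_homog (eh s) _ nb.
  by rewrite eqxx; apply: one_neq0.
rewrite /semigroup_indicator; case: boolp.asboolP => [[m mb]|no] /=; last first.
  case: r e eh span indep indep1 => // r e eh _ _ indep1.
  by case: (indep1 ord0); rewrite -eh hcomp_outside // raddf0.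
case: r e eh span indep indep1 => [|[//|r]] e eh span indep indep1.
  have [s ds cs] := cc.1 m.
  have [|N [c' /(_ b)]] := span 'X_[s]; first by rewrite -mb -ds hcompX.
  rewrite big_ord0 subr0 linearZ /= evX ds mb eqxx cs.
  by move/(@one_neq0 N).
(* Two elements of a basis satisfy the relation with coefficients their values under [ev], swapped
   and with one sign; independence then makes such a value zero, against [indep1]. *)
pose s0 : 'I_r.+2 := ord0; pose s1 : 'I_r.+2 := lift ord0 ord0.
pose c' t := if t == s0 then ev deg c b (e s1)
             else if t == s1 then - ev deg c b (e s0) else 0.
case: (indep1 s1); have [|N /(_ s0)] := indep c'; last by rewrite expr1n mul1r.
rewrite (bigD1 s0) //= (bigD1 s1) //= big1 ?addr0 => [|t /andP[t0 t1]]; last first.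
  by rewrite /c' (negPf t0) (negPf t1) scale0r.
move=> b'; rewrite /c' eqxx /= raddfD /= !linearZ /=.
have [<-|nb] := eqVneq b b'; first by rewrite mulNr mulrC subrr.
by rewrite !(ev_homog _ (eh _) nb) !mulr0 addr0.
Qed.

Section Determinantal.
Variables (C : comNzRingType) (k : nat).
Notation mon := 'X_{1..(3 * k)}.
Notation deg := (@segre_deg 3 k).
Notation dg := (mon_degree deg).
Notation ix := (@mxvec_index 3 k).
Notation x := (@xv 3 k).
Notation J := (@det2_ideal C 3 k).

Lemma det2_minor i j a b : J ('X_[x i a + x j b] - 'X_[x i b + x j a]).
Proof.
wlog ij : i j a b / (i < j)%N.
  move=> W; case: (ltngtP i j) => [/W//|/W ji|/val_inj->].
    by rewrite addmC [(x i b + _)%MM]addmC; exact: ji.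
  by rewrite [(x j b + _)%MM]addmC subrr; apply: (ideal0 (ideal_gen_ideal _)).
wlog ab : a b / (a < b)%N.
  move=> W; case: (ltngtP a b) => [/W//|/W ba|/val_inj->].
    by rewrite -opprB; apply: (idealN (ideal_gen_ideal _)).
  by rewrite subrr; apply: (ideal0 (ideal_gen_ideal _)).
apply: mem_ideal_gen; exists i, j, a, b; split=> //.
by rewrite !mxE -!mpolyXD.
Qed.

Lemma det2_cubic i j l a b c :
  J ('X_[x i a + x j b + x l c] - 'X_[x j a + x l b + x i c]).
Proof.
have idJ : is_ideal J by apply: ideal_gen_ideal.
have -> : 'X_[x i a + x j b + x l c] - 'X_[x j a + x l b + x i c] =
   'X_[x l c] * ('X_[x i a + x j b] - 'X_[x i b + x j a])
   + 'X_[x j a] * ('X_[x i b + x l c] - 'X_[x i c + x l b]) :> {mpoly C[3 * k]}.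
  by rewrite !mpolyXD; ring.
by apply: idealD => //; apply: idealM => //; apply: det2_minor.
Qed.

(** Exchanging the two halves of a circuit changes x^m by a multiple of a minor or of a cubic
    binomial, and lowers the degree of the truncated difference [m - m'] by that of [al]. *)
Lemma det2_binomial m m' : dg m = dg m' -> J ('X_[m] - 'X_[m']).
Proof.
have idJ : is_ideal J by apply: ideal_gen_ideal.
have [N] := ubnP (mdeg (m - m')%MM); elim: N m => // N IHN m ltN e.
have [->|ne] := eqVneq m m'; first by rewrite subrr; apply: ideal0.
have step al be : (al <= m)%MM -> dg al = dg be -> J ('X_[al] - 'X_[be]) ->
    al != 0%MM -> (forall v, 0 < al v -> m' v + al v <= m v)%N ->
    (forall v, 0 < be v -> m v + be v <= m' v)%N -> J ('X_[m] - 'X_[m']).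
  move=> le dab Jab al0 hal hbe; pose m1 := (m - al + be)%MM.
  have mE : m = (m - al + al)%MM by rewrite submK.
  have Jm1 : J ('X_[m1] - 'X_[m']).
    apply: IHN; last by rewrite -e /m1 [in RHS]mE !mon_degreeD dab.
    rewrite -ltnS; apply: leq_trans ltN; rewrite ltnS.
    have -> : (m - m' = (m1 - m') + al)%MM.
      apply/mnmP => v; rewrite !(mnmDE, mnmBE); have := mnm_lepP le v.
      by have := hal v; have := hbe v; lia.
    by rewrite mdegD -[X in (X < _)%N]addn0 ltn_add2l lt0n mdeg_eq0.
  have -> : 'X_[m] - 'X_[m'] =
    'X_[m - al] * ('X_[al] - 'X_[be]) + ('X_[m1] - 'X_[m']) :> {mpoly C[3 * k]}.
    by rewrite {1}mE /m1 !mpolyXD; ring.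
  by apply: idealD => //; apply: idealM.
have sum2 (u u' : mon) i j a b : i != j -> (u (ix i a) + 1 <= u' (ix i a))%N ->
    (u (ix j b) + 1 <= u' (ix j b))%N ->
    forall v, (0 < (x i a + x j b)%MM v -> u v + (x i a + x j b)%MM v <= u' v)%N.
  move=> ij h1 h2 v; rewrite mnmDE !mnm1E.
  case: (eqVneq (ix i a) v) => [<-|_]; last by case: eqP => [<-|].
  by rewrite ix_inj eq_sym (negPf ij).
have sum3 (u u' : mon) i j l a b c : i != j -> j != l -> l != i ->
    (u (ix i a) + 1 <= u' (ix i a))%N -> (u (ix j b) + 1 <= u' (ix j b))%N ->
    (u (ix l c) + 1 <= u' (ix l c))%N ->
    forall v, (0 < (x i a + x j b + x l c)%MM v ->
      u v + (x i a + x j b + x l c)%MM v <= u' v)%N.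
  move=> ij jl li h1 h2 h3 v; rewrite !mnmDE !mnm1E.
  case: (eqVneq (ix i a) v) => [<-|_].
    by rewrite !ix_inj eq_sym (negPf ij) (negPf li).
  case: (eqVneq (ix j b) v) => [<-|_]; last by case: eqP => [<-|].
  by rewrite !ix_inj eq_sym (negPf jl).
case: (circuit_exists e ne) => [[i [j [a [b [ij h1 h2 h3 h4]]]]]|].
  apply: (step (x i a + x j b)%MM (x i b + x j a)%MM).
  - by apply: le_xv2 => //; lia.
  - by have := dg_swap i j a b 0%MM; rewrite !addm0.
  - exact: det2_minor.
  - by rewrite mnmD_eq0 mnm1_eq0.
  - by apply: sum2; rewrite // addn1.
  - by apply: sum2; rewrite // addn1.
move=> [i [j [l [a [b [c [[ij jl li] [h1 h2 h3] [h4 h5 h6]]]]]]]].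
apply: (step (x i a + x j b + x l c)%MM (x j a + x l b + x i c)%MM).
- by apply: le_xv3 => //; lia.
- exact: dg_cycle.
- exact: det2_cubic.
- by rewrite !mnmD_eq0 mnm1_eq0.
- by apply: sum3; rewrite // addn1.
- by apply: sum3; rewrite // ?addn1 // eq_sym.
Qed.

(** The right-hand side is the toric ideal, generated by the binomials x^m - x^m' with both
    monomials of one degree. *)
Lemma det2_idealE : J = cohI deg (chi C xpredT).
Proof.
have cT : pcoh deg xpredT by split=> // m; exists m.
apply: boolp.funext => p; apply: boolp.propext; split.
  apply: ideal_gen_min; first exact: cohI_ideal (coh_chi C cT).
  move=> _ [i [j [a [b [_ _ ->]]]]] d; rewrite !mxE -!mpolyXD raddfB /= !evX.
  have -> : dg (U_(ix i b) + U_(ix j a))%MM = dg (U_(ix i a) + U_(ix j b))%MM.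
    by have := dg_swap i j b a 0%MM; rewrite !addm0.
  by case: ifP; rewrite subrr.
have [r rP] : exists r : _ -> mon, forall m, dg (r (dg m)) = dg m.
  have /boolp.choice[r rP] : forall b, exists s, (exists m, dg m = b) -> dg s = b.
    move=> b; have [[m <-]|no] := boolp.pselect (exists m, dg m = b).
      by exists m.
    by exists 0%MM => /no.
  by exists r => m; apply: rP; exists m.
move=> /(cohI_expand rP) ->; apply: ideal_sum => [|m _ _]; first exact: ideal_gen_ideal.
rewrite -mul_mpolyC; apply: idealM; first exact: ideal_gen_ideal.
by rewrite scale1r; apply: det2_binomial.
Qed.

End Determinantal.

Lemma toric_hilbert_schemeE (C : fieldType) (k : nat) (A : comAlgType C)
    (I : {mpoly A[3 * k]} -> Prop) :
  toric_hilbert_scheme (@segre_deg 3 k) (@det2_ideal C 3 k) I <->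
  multigraded_hilbert_scheme (@segre_deg 3 k)
    (semigroup_indicator (@segre_deg 3 k)) I.
Proof.
have cT : pcoh (@segre_deg 3 k) xpredT by split=> // m; exists m.
have cc := coh_chi C cT.
split=> [[h [hJ hI]]|hI].
  have -> : semigroup_indicator (@segre_deg 3 k) = h; last by [].
  apply: boolp.funext => b; apply/esym/(cohI_rank_unique cc).
  by rewrite -det2_idealE; apply: hJ.
exists (semigroup_indicator (@segre_deg 3 k)); split=> // b.
by rewrite det2_idealE; apply: cohI_free.
Qed.

Theorem theorem2 (R : realType) (k : nat) (hk : (1 <= k)%N) :
  is_connected
    (toric_hilbert_scheme (@segre_deg 3 k) (@det2_ideal R[i] 3 k)).
Proof.
apply: (@connected_of_degenerations R[i] _ _ (@segre_deg 3 k)).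
  by move=> A I; apply: toric_hilbert_schemeE.
by move=> Q inv S; apply: sort_to_generic.
Qed.
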